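(* Let $1<p<\infty$. On the rearrangement-invariant space $(L^1+L^p)(\mathbb{R})$, the segment multiplier $S$ is bounded, while the Hilbert transform $H$ is not bounded. The same holds for the rearrangement-invariant space $(L^p\cap L^\infty)(\mathbb{R})$: $S$ is bounded on it, while $H$ is not.
   Context: $Sf(x)=\int_{\mathbb{R}}\frac{\sin(x-y)}{x-y}f(y)\,dy$ and $Hf(x)=\mathrm{p.v.}\int_{\mathbb{R}}\frac{f(y)}{x-y}\,dy$. The space $L^1+L^p$ consists of all $f=g+h$ with $g\in L^1(\mathbb{R})$, $h\in L^p(\mathbb{R})$, normed by $\|f\|_{L^1+L^p}=\inf\{\|g\|_1+\|h\|_p: f=g+h,\ g\in L^1,\ h\in L^p\}$. The space $L^p\cap L^\infty$ is normed by $\|f\|=\max\{\|f\|_p,\|f\|_\infty\}$. An operator $T$ is bounded on $X$ if $Tf$ is defined a.e. and belongs to $X$ for every $f\in X$, with $\|Tf\|_X\le C\|f\|_X$ for a constant $C$ independent of $f$. *)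

(* Defs.v *)
From HB Require Import structures.
From mathcomp Require Import all_boot all_order all_algebra.
From mathcomp Require Import complex.
From mathcomp Require Import all_classical all_reals all_analysis.

Set Implicit Arguments.
Unset Strict Implicit.
Unset Printing Implicit Defensive.

Import Order.TTheory GRing.Theory Num.Theory.
Import numFieldNormedType.Exports.

Local Open Scope classical_set_scope.
Local Open Scope ring_scope.
Local Open Scope complex_scope.

Notation leb := (@lebesgue_measure _).

Section SegmentAndHilbert.
Context {R : realType}.
Implicit Types (f g h u : R -> R[i]) (p : \bar R) (D : set R).

Definition cmod (z : R[i]) : R := Normc.normc z.

(* Measurability on R is Borel measurability here; every Lebesgue measurable
   function has a Borel measurable representative, so the classes modulo
   almost everywhere equality are the usual ones. *)
Definition Lp p : set (R -> R[i]) :=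
  [set f | [/\ measurable_fun [set: R] (fun x : R => complex.Re (f x)),
               measurable_fun [set: R] (fun x : R => complex.Im (f x)) &
               cmod \o f \in Lfun leb p]].

Definition Lp_norm p f : \bar R := ('N[leb]_p[ EFin \o (cmod \o f) ])%E.

Definition sumL1Lp p : set (R -> R[i]) :=
  [set f | exists g h,
     [/\ Lp 1%:E g, Lp p h & forall x : R, f x = g x + h x]].

Definition sumL1Lp_norm p f : \bar R :=
  ereal_inf [set t | exists g h,
    [/\ Lp 1%:E g, Lp p h, forall x : R, f x = g x + h x &
        t = (Lp_norm 1%:E g + Lp_norm p h)%E]].

Definition capLpLoo p : set (R -> R[i]) := Lp p `&` Lp +oo%E.

Definition capLpLoo_norm p f : \bar R :=
  maxe (Lp_norm p f) (Lp_norm +oo%E f).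

Definition cintegrable D f : Prop :=
  leb.-integrable D (fun x => (complex.Re (f x))%:E) /\
  leb.-integrable D (fun x => (complex.Im (f x))%:E).

Definition cintegral D f : R[i] :=
  (\int[leb]_(x in D) complex.Re (f x)) +i*
  (\int[leb]_(x in D) complex.Im (f x)).

(* The operators below are partial: [T f x v] means that [T f] is defined at
   [x], with value [v]. *)

(* At [y = x] the quotient is [0 / 0 = 0] instead of [1], which does not affect
   the integral. *)
Definition segment_mult f (x : R) (v : R[i]) : Prop :=
  let F (y : R) := (sin (x - y) / (x - y))%:C * f y in
  cintegrable [set: R] F /\ v = cintegral [set: R] F.

(* The principal value: the limit, as [e] decreases to [0], of the integral
   over the complement of [[x - e, x + e]]. *)
Definition hilbert f (x : R) (v : R[i]) : Prop :=
  let F (y : R) := ((x - y)^-1)%:C * f y in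
  let D (e : R) := [set y : R | e < `|x - y|] in
  (forall e : R, 0 < e -> cintegrable (D e) F) /\
  cmod (cintegral (D e) F - v) @[e --> 0^'+] --> 0.

(* [u] is a representative in [X] of the almost everywhere defined function
   [T f]. *)
Definition bounded_on (X : set (R -> R[i])) (N : (R -> R[i]) -> \bar R)
    (T : (R -> R[i]) -> R -> R[i] -> Prop) : Prop :=
  exists C : R, forall f, X f ->
    exists u, [/\ X u, {ae leb, forall x : R, T f x (u x)} &
                  (N u <= C%:E * N f)%E].

End SegmentAndHilbert.

(* Main.v *)
Require Import Defs.
From mathcomp Require Import all_boot all_order all_algebra.
From mathcomp Require Import complex ring lra.
From mathcomp Require Import all_classical all_reals all_analysis.
From mathcomp Require Import measurable_realfun ess_sup_inf.

Set Implicit Arguments.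
Unset Strict Implicit.
Unset Printing Implicit Defensive.

Import Order.TTheory GRing.Theory Num.Theory.
Import numFieldNormedType.Exports.

Local Open Scope classical_set_scope.
Local Open Scope complex_scope.
Local Open Scope ring_scope.

(** The operator S is the convolution with sin t / t, which is O(1 / (1 + |t|))
    and hence lies in every Lr with r > 1. So S maps L1 into Lp ([young_Sop]),
    and Lp into the bounded functions by Hoelder's inequality
    ([segment_pointwise]). If S also maps Lp into itself ([riesz_Sop]), then it
    is bounded on L1 + Lp, where Sf can be taken as its own Lp component, and on
    the intersection of Lp and Loo.

    The bound on Lp is a form of M. Riesz's theorem, and has to be proved. Since
    sin (x - t) = sin x cos t - cos x sin t, up to an integrable kernel it
    suffices to bound the convolution with the conjugate Poisson kernel
    t / (1 + t^2) ([Sop_decomp]). Let f >= 0 be bounded with compact support. The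
    function G(z) = i int f(t) / (z - t) dt = u + i v is holomorphic on the upper
    half-plane with u > 0, so that G^p is defined; it is O(|z|^(-p)).
    Shifting the line of integration to infinity, the integral of G^p along the
    line of height one is 0 ([integral_repow_decay]); the shift is done with real
    variables, by differentiating in the height and using the Cauchy-Riemann
    equations. For 1 < p <= 2 there are constants with
    |v|^p <= A u^p - B Re (G^p) ([riesz_pointwise]), and integrating this shows
    that v, the conjugate Poisson integral of f, is controlled in Lp by its
    Poisson integral u, hence by f ([riesz_ge0]). As the kernel of S is even, the
    exponents p > 2 follow by duality ([riesz_Sop_gt2]).

    The Hilbert transform is tested on multiples of indicators of [0, d], where
    it is explicit to the right of d ([hilbert_box]). For (1 / d) 1_[0, d], which
    has norm at most 1 in L1 + Lp, it is at least 1 / x on ]d, 1], and the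
    integral of 1 / x there, ln (1 / d), is not bounded as d decreases to 0. For
    the indicator of [0, 1], it is not bounded near 1. *)

(** * A weighted Jensen inequality *)

(** The inverse is discontinuous at 0; writing it as x (x^2)^(-1) reduces its
    measurability to that of real powers. *)
Lemma measurable_invr (R : realType) : measurable_fun [set: R] (@GRing.inv R).
Proof.
have -> : @GRing.inv R = fun x => x * (x ^+ 2) `^ (-1).
  apply/funext => x; rewrite powR_inv1 ?sqr_ge0//.
  have [->|x0] := eqVneq x 0; first by rewrite mul0r invr0.
  by rewrite expr2 invfM mulrA divff// mul1r.
apply: measurable_funM => //.
apply: (measurableT_comp (@measurable_powR R _)).
exact: measurable_funX.
Qed.

Section weighted_jensen.
Context d (T : measurableType d) (R : realType).
Variable mu : {measure set T -> \bar R}.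
Local Open Scope ereal_scope.

(** Hoelder's inequality for the splitting a b = a^(1/q) (a^(1/p) b). Young's
    inequality and the Lp bounds for integrable kernels all come from it, with
    the weight a taken either as the function or as the kernel. *)
Lemma weighted_jensen (a b : T -> R) (p A : R) : (1 < p)%R ->
  measurable_fun [set: T] a -> measurable_fun [set: T] b ->
  (forall x, 0 <= a x)%R -> (forall x, 0 <= b x)%R ->
  \int[mu]_x (a x)%:E <= A%:E ->
  (\int[mu]_x (a x * b x)%:E) `^ p <=
    (A `^ (p - 1))%:E * \int[mu]_x (a x * b x `^ p)%:E.
Proof.
move=> p1 ma mb a0 b0 aA.
have p0 : (0 < p)%R by apply: lt_trans p1.
have pB0 : (0 < p - 1)%R by rewrite subr_gt0.
pose q := (p / (p - 1))%R.
have q0 : (0 < q)%R by rewrite divr_gt0.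
have pq : (q^-1 + p^-1 = 1)%R by rewrite /q; field; rewrite !gt_eqF.
have mpow (f : T -> R) r : measurable_fun [set: T] f ->
    measurable_fun [set: T] (fun x => f x `^ r)%R.
  by move=> mf; exact: (measurableT_comp (@measurable_powR R r)).
(* a b = f g, with int f^q = int a and int g^p = int a b^p *)
pose f x := (a x `^ q^-1)%R.
pose g x := (a x `^ p^-1 * b x)%R.
have mf : measurable_fun [set: T] f by exact: mpow.
have mg : measurable_fun [set: T] g by apply: measurable_funM => //; exact: mpow.
have fgE x : (f x * g x = a x * b x)%R.
  by rewrite /f /g mulrA -powRD ?pq ?oner_eq0//= powRr1.
have fg0 x : (0 <= f x * g x)%R by rewrite fgE mulr_ge0.
have := hoelder mu mf mg q0 p0 pq.
rewrite Lnorm1 => H.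
have H1 : \int[mu]_x (a x * b x)%:E <=
    (\int[mu]_x (a x)%:E) `^ q^-1 * (\int[mu]_x (a x * b x `^ p)%:E) `^ p^-1.
  apply: le_trans; last apply: le_trans H _.
    rewrite le_eqVlt; apply/orP; left; apply/eqP; apply: eq_integral => x _ /=.
    by rewrite fgE ger0_norm// mulr_ge0.
  rewrite unlock le_eqVlt; apply/orP; left; apply/eqP; congr (_ `^ _ * _ `^ _).
    apply: eq_integral => x _ /=; rewrite ger0_norm ?powR_ge0//.
    by rewrite /f -powRrM mulVf ?gt_eqF// powRr1.
  apply: eq_integral => x _ /=; rewrite ger0_norm ?mulr_ge0 ?powR_ge0//.
  rewrite /g powRM ?powR_ge0//.
  by rewrite -powRrM mulVf ?gt_eqF// powRr1.
have I0 : 0 <= \int[mu]_x (a x * b x)%:E.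
  by apply: integral_ge0 => x _; rewrite lee_fin mulr_ge0.
have J0 : 0 <= \int[mu]_x (a x * b x `^ p)%:E.
  by apply: integral_ge0 => x _; rewrite lee_fin mulr_ge0 ?powR_ge0.
have K0 : 0 <= \int[mu]_x (a x)%:E.
  by apply: integral_ge0 => x _; rewrite lee_fin.
have inI (z : \bar R) : 0 <= z -> z \in `[0, +oo] by rewrite in_itv/= leey andbT.
apply: (@le_trans _ _ (((\int[mu]_x (a x)%:E) `^ q^-1 *
    (\int[mu]_x (a x * b x `^ p)%:E) `^ p^-1) `^ p)).
  apply: gt0_ler_poweR => //; rewrite ?inI ?mule_ge0 ?poweR_ge0//.
  exact: ltW.
rewrite poweRM ?poweR_ge0// -!poweRrM mulVf ?gt_eqF// poweRe1//.
have -> : (q^-1 * p = p - 1)%R.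
  by rewrite /q; field; rewrite !gt_eqF.
apply: lee_wpmul2r => //.
rewrite -poweR_EFin.
apply: gt0_ler_poweR => //; rewrite ?inI//; first exact: ltW.
exact: le_trans aA.
Qed.

End weighted_jensen.

(** * Power integrals of kernels, derivatives of real functions, decay *)

Section schur.
Context d1 d2 (T1 : measurableType d1) (T2 : measurableType d2) (R : realType).
Variables (m1 : {sigma_finite_measure set T1 -> \bar R})
          (m2 : {sigma_finite_measure set T2 -> \bar R}).
Local Open Scope ereal_scope.

(** The weighted Jensen inequality in y for each fixed x, then Tonelli. *)
Lemma integral_power_kernel (a b : T1 * T2 -> R) (p A : R) : (1 < p)%R ->
  measurable_fun [set: T1 * T2] a -> measurable_fun [set: T1 * T2] b ->
  (forall z, 0 <= a z)%R -> (forall z, 0 <= b z)%R ->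
  (forall x, \int[m2]_y (a (x, y))%:E <= A%:E) ->
  \int[m1]_x ((\int[m2]_y (a (x, y) * b (x, y))%:E) `^ p) <=
  (A `^ (p - 1))%:E * \int[m2]_y \int[m1]_x (a (x, y) * b (x, y) `^ p)%:E.
Proof.
move=> p1 ma mb a0 b0 aA.
have mbp : measurable_fun [set: T1 * T2] (fun z => b z `^ p)%R.
  by apply: (measurableT_comp (@measurable_powR R p)).
have mab : measurable_fun [set: T1 * T2] (fun z => (a z * b z)%:E).
  by apply/measurable_EFinP; apply: measurable_funM.
have mabp : measurable_fun [set: T1 * T2] (fun z => (a z * b z `^ p)%:E).
  by apply/measurable_EFinP; apply: measurable_funM.
have ab0 z : 0 <= (a z * b z)%:E by rewrite lee_fin mulr_ge0.
have abp0 z : 0 <= (a z * b z `^ p)%:E by rewrite lee_fin mulr_ge0 ?powR_ge0.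
rewrite -(@fubini_tonelli _ _ _ _ _ m1 m2 (fun z => (a z * b z `^ p)%:E))//.
rewrite -ge0_integralZl//; last 3 first.
- exact: (@measurable_fun_fubini_tonelli_F _ _ _ _ _ m2
            (fun z => (a z * b z `^ p)%:E)).
- by move=> x _; apply: integral_ge0.
- by rewrite lee_fin powR_ge0.
apply: ge0_le_integral => //.
- by move=> x _; rewrite poweR_ge0.
- apply: (measurableT_comp (measurable_poweR p)).
  exact: (@measurable_fun_fubini_tonelli_F _ _ _ _ _ m2
            (fun z => (a z * b z)%:E)).
- apply: emeasurable_funM => //.
  exact: (@measurable_fun_fubini_tonelli_F _ _ _ _ _ m2
            (fun z => (a z * b z `^ p)%:E)).
- move=> x _; apply: (weighted_jensen (a := fun y => a (x, y))
                        (b := fun y => b (x, y))) => //.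
  + by apply: (measurableT_comp ma).
  + by apply: (measurableT_comp mb).
Qed.

End schur.

Section is_derive_real.
Context (R : realType).
Implicit Types (f g : R -> R) (x a b c : R).

(** The calculus rules with the functions applied to their argument, in which
    form they chain without rewriting. *)
Lemma is_deriveDr f g x a b : is_derive x 1 f a -> is_derive x 1 g b ->
  is_derive x 1 (fun y => f y + g y) (a + b).
Proof. by move=> ? ?; apply: is_deriveD. Qed.

Lemma is_deriveBr f g x a b : is_derive x 1 f a -> is_derive x 1 g b ->
  is_derive x 1 (fun y => f y - g y) (a - b).
Proof. by move=> ? ?; apply: is_deriveB. Qed.

Lemma is_deriveMr f g x a b : is_derive x 1 f a -> is_derive x 1 g b ->
  is_derive x 1 (fun y => f y * g y) (f x * b + g x * a).
Proof. by move=> ? ?; apply: is_deriveM. Qed.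

Lemma is_deriveZr f c x a : is_derive x 1 f a ->
  is_derive x 1 (fun y => c * f y) (c * a).
Proof. by move=> ?; apply: (is_deriveZ c). Qed.

Lemma is_deriveVr f x a : f x != 0 -> is_derive x 1 f a ->
  is_derive x 1 (fun y => (f y)^-1) (- a / f x ^+ 2).
Proof.
move=> fx df; have /is_derive_eq := is_deriveV fx df; apply.
by rewrite /GRing.scale/= mulrC mulrN mulNr.
Qed.

Lemma is_derive_comp f g x a b : is_derive (g x) 1 f a -> is_derive x 1 g b ->
  is_derive x 1 (fun y => f (g y)) (a * b).
Proof. by move=> ? ?; apply: is_derive1_comp. Qed.

Lemma is_derive_idr x : is_derive x 1 (fun y : R => y) 1.
Proof. exact: is_derive_id. Qed.

Lemma is_derive_cstr x c : is_derive x 1 (fun _ : R => c) 0.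
Proof. exact: is_derive_cst. Qed.

Lemma is_derive_continuous f x a : is_derive x 1 f a -> {for x, continuous f}.
Proof.
by case=> /derivable1_diffP /differentiable_continuous.
Qed.

End is_derive_real.

Section decay.
Context (R : realType).
Implicit Types (x y q : R).

(** An explicit majorant: sin t / t is of order decay 1 and the Poisson kernel
    of order decay 2. Powers of these functions are of the same form and are
    integrated explicitly. *)
Definition decay q x : R := (1 + `|x|) `^ (- q).

Lemma decay_ge0 q x : 0 <= decay q x.
Proof. exact: powR_ge0. Qed.

Lemma oneDnorm_gt0 x : 0 < 1 + `|x|.
Proof. by rewrite (lt_le_trans ltr01)// lerDl. Qed.

Lemma continuous_decay q : continuous (decay q).
Proof.
move=> x; apply: (@continuous_comp _ _ _ (fun x : R => 1 + `|x|) (fun x => x `^ (- q))).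
  by apply: cvgD; [exact: cvg_cst|exact: norm_continuous].
exact: is_derive_continuous (is_derive1_powR (- q) (oneDnorm_gt0 x)).
Qed.

Lemma measurable_decay q : measurable_fun [set: R] (decay q).
Proof. exact: continuous_measurable_fun (@continuous_decay q). Qed.

Lemma decay_pow q p x : decay q x `^ p = decay (q * p) x.
Proof. by rewrite /decay -powRrM mulNr. Qed.

Lemma cvg_powRN_pinfty q : 0 < q -> x `^ (- q) @[x --> +oo] --> (0 : R).
Proof.
move=> q0; apply/cvgrPdist_le => e e0; near=> x.
have x0 : 0 < x by [].
rewrite sub0r normrN ger0_norm ?powR_ge0// powRN.
rewrite -[leRHS]invrK lef_pV2 ?posrE ?invr_gt0 ?powR_gt0//.
have -> : e^-1 = (e^-1 `^ q^-1) `^ q.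
  by rewrite -powRrM mulVf ?gt_eqF// powRr1// invr_ge0 ltW.
by apply: ge0_ler_powR; rewrite ?nnegrE ?powR_ge0// ltW.
Unshelve. all: by end_near. Qed.

Lemma integral_decay0 q : 1 < q ->
  (\int[leb]_x (decay q x)%:E = (2 / (q - 1))%:E)%E.
Proof.
move=> q1; have qB : 0 < q - 1 by rewrite subr_gt0.
rewrite ge0_symfun_integralT; last 3 first.
- exact: decay_ge0.
- exact: continuous_decay.
- by move=> x /=; rewrite /decay normrN.
rewrite -set_itvcy.
pose F x : R := - (q - 1)^-1 * (1 + x) `^ (- (q - 1)).
have Fder x : 0 < 1 + x -> is_derive x 1 F ((1 + x) `^ (- q)).
  move=> x0.
  have := is_deriveZr (- (q - 1)^-1) (is_derive_comp (is_derive1_powR (- (q - 1)) x0)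
    (is_deriveDr (is_derive_cstr x 1) (is_derive_idr x))).
  move/is_derive_eq; apply.
  rewrite add0r mulr1 mulrA mulrNN mulVf ?gt_eqF// mul1r.
  by congr (_ `^ _); ring.
rewrite (@ge0_continuous_FTC2y _ _ F 0 0).
- rewrite /F addr0 powR1 mulr1 -EFinB -EFinM; congr EFin.
  by rewrite sub0r opprK.
- by move=> x _; exact: decay_ge0.
- by apply: continuous_subspaceT; exact: continuous_decay.
- rewrite -[X in _ --> X](mulr0 (- (q - 1)^-1)); apply: cvgM; first exact: cvg_cst.
  apply: (@cvg_comp _ _ _ (fun x : R => 1 + x) (fun x : R => x `^ _) _ +oo).
    apply/cvgryPge => A; near=> x; rewrite -lerBlDl.
    by near: x; apply: nbhs_pinfty_ge; rewrite num_real.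
  exact: cvg_powRN_pinfty.
- move=> x x0; have : 0 < 1 + x by rewrite addr_gt0. by move/Fder => [].
- apply: cvg_at_right_filter; apply: (is_derive_continuous (a := (1 + 0) `^ (- q))).
  by apply: Fder; rewrite addr0.
- move=> x; rewrite in_itv/= andbT => x0.
  have : 0 < 1 + x by rewrite addr_gt0.
  by move/Fder => /@derive_val; rewrite derive1E => ->; rewrite /decay gtr0_norm.
Unshelve. all: by end_near. Qed.

Lemma integral_decay q y : 1 < q ->
  (\int[leb]_x (decay q (x - y))%:E = (2 / (q - 1))%:E)%E.
Proof.
move=> q1; rewrite -(integral_decay0 q1); apply/esym.
have dB x : is_derive x 1 (fun x : R => x - y) 1.
  have /is_derive_eq := is_deriveBr (is_derive_idr x) (is_derive_cstr x y).
  by apply; rewrite subr0.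
have dE : ((fun x : R => x - y)^`())%classic = cst 1.
  by apply/funext => x; rewrite derive1E; apply: (@derive_val _ _ _ _ _ _ _ (dB x)).
rewrite (@increasing_ge0_integration_by_substitutionT _ (fun x => x - y) (decay q)).
- by apply: eq_integral => x _; rewrite dE /= mulr1.
- by move=> x z xz; rewrite ltrD2r.
- by rewrite dE => x; exact: cvg_cst.
- by rewrite dE; exact: is_cvg_cst.
- by rewrite dE; exact: is_cvg_cst.
- by move=> x; case: (dB x).
- apply/cvgrNyPle => A; near=> x; rewrite lerBlDr.
  by near: x; apply: nbhs_ninfty_le; rewrite num_real.
- apply/cvgryPge => A; near=> x; rewrite lerBrDr.
  by near: x; apply: nbhs_pinfty_ge; rewrite num_real.
- exact: continuous_decay.
- exact: decay_ge0.
Unshelve. all: by end_near. Qed.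

Lemma integral_decayC q x : 1 < q ->
  (\int[leb]_y (decay q (x - y))%:E = (2 / (q - 1))%:E)%E.
Proof.
move=> q1; rewrite -(integral_decay x q1).
by apply: eq_integral => y _; rewrite /decay distrC.
Qed.

End decay.

Section fatou.
Context d (T : measurableType d) (R : realType).
Variable mu : {measure set T -> \bar R}.
Local Open Scope ereal_scope.

(** Fatou's lemma in the form used here: a bound that holds up to any e for all
    late terms passes to the pointwise limit. *)
Lemma fatou_le (g_ : (T -> \bar R)^nat) (g : T -> \bar R) (z : \bar R) :
  (forall n, measurable_fun [set: T] (g_ n)) ->
  (forall n x, 0 <= g_ n x) ->
  (forall x, g_ n x @[n --> \oo] --> g x) ->
  (forall e : R, (0 < e)%R -> \forall n \near \oo, \int[mu]_x g_ n x <= z + e%:E) ->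
  \int[mu]_x g x <= z.
Proof.
move=> mg g0 gg H.
have -> : \int[mu]_x g x = \int[mu]_x limn_einf (g_^~ x).
  apply: eq_integral => x _.
  have [-> _] := cvg_limn_einf_sup (gg x).
  by [].
apply: le_trans (fatou mu measurableT mg (fun n x _ => g0 n x)) _.
apply/lee_addgt0Pr => e e0.
have [N _ HN] := H _ e0.
rewrite limn_einf_lim; apply: lime_le; first exact: is_cvg_einfs.
apply: nearW => n; apply: le_trans (HN (maxn n N) _); last exact: leq_maxr.
apply: ereal_inf_lbound; exists (maxn n N) => //=; exact: leq_maxl.
Qed.

End fatou.

(** * Riesz's pointwise inequality and the powers of a holomorphic function *)

Section riesz_inequality.
Context (R : realType).
Implicit Types (p u v t : R).

(** Near |t| = pi / 2 the number cos (p t) is negative, because pi / 2 < p pi /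
    2 <= pi, and - B cos (p t) exceeds 1 for a large B; away from pi / 2 the
    cosine is bounded below and a large A takes over. *)
Lemma riesz_trig p : 1 < p -> p <= 2 -> exists A B : R, [/\ 0 <= A, 0 <= B &
  forall t, `|t| < pi / 2 -> 1 <= A * cos t `^ p - B * cos (p * t)].
Proof.
move=> p1 p2; have pi0 := pi_gt0 R.
have p0 : 0 < p by lra.
(* p t0 is the midpoint of pi / 2 and p pi / 2 *)
pose t0 : R := pi * (p + 1) / (4 * p).
have pt0 : p * t0 = pi * (p + 1) / 4 by rewrite /t0; field; rewrite gt_eqF.
have t00 : 0 < t0 by rewrite /t0 divr_gt0 ?mulr_gt0//; lra.
have t0pi : t0 < pi / 2.
  rewrite /t0 ltr_pdivrMr ?mulr_gt0//; nra.
have pt0_ge : pi / 2 < p * t0 by rewrite pt0; nra.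
have pt0_le : p * t0 <= pi by rewrite pt0; nra.
have c0 : cos (p * t0) < 0.
  rewrite -cos_pihalf ltr_cos// in_itv/=; apply/andP; split; nra.
have d0 : 0 < cos t0 by apply: cos_gt0_pihalf; apply/andP; split; lra.
have d0p : 0 < cos t0 `^ p by exact: powR_gt0.
pose B := - (cos (p * t0))^-1.
have B0 : 0 <= B by rewrite /B oppr_ge0 invr_le0 ltW.
exists ((1 + B) / cos t0 `^ p), B; split => //.
  by rewrite divr_ge0 ?addr_ge0// ltW.
move=> t; wlog t0' : t / 0 <= t => [H|].
  have [/H//|tN] := leP 0 t.
  rewrite -normrN => /(H (- t)); rewrite mulrN !cosN; apply.
  by rewrite oppr_ge0 ltW.
rewrite ger0_norm// => tpi.
have ct : 0 <= cos t by apply: cos_ge0_pihalf; apply/andP; split; lra.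
have [tt0|tt0] := leP t0 t.
  have : cos (p * t) <= cos (p * t0).
    move: tt0; rewrite le_eqVlt => /predU1P[->//|tt0]; apply: ltW.
    by rewrite ltr_cos ?in_itv/= ?ltr_pM2l//; apply/andP; split; nra.
  move=> cc; have : 1 <= - (B * cos (p * t)).
    by rewrite /B mulNr opprK mulrC ler_ndivlMr// mul1r.
  have : 0 <= (1 + B) / cos t0 `^ p * cos t `^ p.
    by rewrite mulr_ge0 ?powR_ge0// divr_ge0 ?addr_ge0// ltW.
  lra.
have cc : cos t0 `^ p <= cos t `^ p.
  have ctt : cos t0 < cos t.
    by rewrite ltr_cos// ?in_itv/=; apply/andP; split; lra.
  by apply: ge0_ler_powR; rewrite ?nnegrE; lra.
have : 1 + B <= (1 + B) / cos t0 `^ p * cos t `^ p.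
  rewrite -mulrA ler_peMr ?addr_ge0//.
  by rewrite mulrC ler_pdivlMr// mul1r.
have : B * cos (p * t) <= B by rewrite ler_piMr// cos_le1.
lra.
Qed.

(** The trigonometric inequality in polar coordinates: with u + i v = r e^(i t)
    and u > 0, one multiplies it by r^p and uses |v| <= r. The last term is B
    times the real part of (u + i v)^p. *)
Lemma riesz_pointwise p : 1 < p -> p <= 2 -> exists A B : R, [/\ 0 <= A, 0 <= B &
  forall u v, 0 < u -> `|v| `^ p <= A * u `^ p -
    B * ((u ^+ 2 + v ^+ 2) `^ (p / 2) * cos (p * atan (v / u)))].
Proof.
move=> p1 p2; have [A [B [A0 B0 H]]] := riesz_trig p1 p2.
have p0 : 0 < p by lra.
exists A, B; split => // u v u0.
have r0 : 0 < u ^+ 2 + v ^+ 2 by rewrite ltr_wpDr ?sqr_ge0 ?exprn_gt0.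
have ct : cos (atan (v / u)) = u / Num.sqrt (u ^+ 2 + v ^+ 2).
  rewrite cos_atan.
  have -> : 1 + (v / u) ^+ 2 = (u ^+ 2 + v ^+ 2) / u ^+ 2.
    by rewrite expr_div_n; field; rewrite gt_eqF.
  by rewrite sqrtrM ?ltW// sqrtrV ?sqr_ge0// sqrtr_sqr gtr0_norm// invfM invrK mulrC.
have /H : `|atan (v / u)| < pi / 2.
  by rewrite ltr_norml atan_gtNpi2 atan_ltpi2.
rewrite ct => H1.
pose s := (u ^+ 2 + v ^+ 2) `^ (p / 2).
have s0 : 0 < s by exact: powR_gt0.
have vs : `|v| `^ p <= s.
  have -> : `|v| `^ p = (v ^+ 2) `^ (p / 2).
    rewrite -(real_normK (num_real v)) -powR_mulrn// -powRrM.
    by congr (_ `^ _); lra.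
  apply: ge0_ler_powR; rewrite ?nnegrE ?sqr_ge0 ?addr_ge0 ?sqr_ge0//.
    by rewrite divr_ge0// ltW.
  by rewrite lerDr sqr_ge0.
apply: (le_trans vs).
have -> : A * u `^ p = s * (A * (u / Num.sqrt (u ^+ 2 + v ^+ 2)) `^ p).
  rewrite powRM ?invr_ge0 ?sqrtr_ge0 ?ltW//.
  have -> : (Num.sqrt (u ^+ 2 + v ^+ 2))^-1 `^ p = s^-1.
    rewrite -powR12_sqrt ?ltW// -[_^-1]powR_inv1 ?powR_ge0// -!powRrM.
    by rewrite -powRN; congr (_ `^ _); lra.
  by field; rewrite gt_eqF.
rewrite -/s [X in _ - X]mulrCA -mulrBr.
by rewrite -[leLHS]mulr1 ler_pM2l.
Qed.

(** The real part of (u + i v)^p for the principal branch, when u > 0. *)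
Definition repow p u v := (u ^+ 2 + v ^+ 2) `^ (p / 2) * cos (p * atan (v / u)).
(** The imaginary part of (u + i v)^p for the principal branch, when u > 0. *)
Definition impow p u v := (u ^+ 2 + v ^+ 2) `^ (p / 2) * sin (p * atan (v / u)).

Lemma is_derive_modulus p (U V : R -> R) x a b : 0 < U x ->
  is_derive x 1 U a -> is_derive x 1 V b ->
  is_derive x 1 (fun y => (U y ^+ 2 + V y ^+ 2) `^ (p / 2))
    (p * (U x ^+ 2 + V x ^+ 2) `^ (p / 2) / (U x ^+ 2 + V x ^+ 2) * (U x * a + V x * b)).
Proof.
move=> U0 dU dV.
have r0 : 0 < U x ^+ 2 + V x ^+ 2 by rewrite ltr_wpDr ?sqr_ge0 ?exprn_gt0.
have dr := is_deriveDr (is_deriveMr dU dU) (is_deriveMr dV dV).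
have /is_derive_eq := @is_derive_comp R (fun y => y `^ (p / 2))
  (fun y => U y ^+ 2 + V y ^+ 2) x _ _ (is_derive1_powR (p / 2) r0) dr.
apply; rewrite powRB ?powRr1 ?(ltW r0)//; last by rewrite (gt_eqF r0) implybT.
by field; rewrite gt_eqF.
Qed.

Lemma is_derive_argument (U V : R -> R) x a b : 0 < U x ->
  is_derive x 1 U a -> is_derive x 1 V b ->
  is_derive x 1 (fun y => atan (V y / U y))
    ((U x * b - V x * a) / (U x ^+ 2 + V x ^+ 2)).
Proof.
move=> U0 dU dV.
have r0 : 0 < U x ^+ 2 + V x ^+ 2 by rewrite ltr_wpDr ?sqr_ge0 ?exprn_gt0.
have U1 : U x != 0 by rewrite gt_eqF.
have /is_derive_eq := is_derive_comp (is_derive1_atan _)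
   (is_deriveMr dV (is_deriveVr U1 dU)).
by apply; field; rewrite U1/= !gt_eqF.
Qed.

(** This lemma and its analogue for impow express that z^p is holomorphic on the
    right half-plane: along u + i v, the Cauchy-Riemann equations for u and v
    give those for the real and imaginary parts of the power. *)
Lemma is_derive_repow p (U V : R -> R) x a b : 0 < U x ->
  is_derive x 1 U a -> is_derive x 1 V b ->
  is_derive x 1 (fun y => repow p (U y) (V y))
    (p * (U x ^+ 2 + V x ^+ 2) `^ (p / 2) / (U x ^+ 2 + V x ^+ 2) *
     ((U x * a + V x * b) * cos (p * atan (V x / U x)) -
      (U x * b - V x * a) * sin (p * atan (V x / U x)))).
Proof.
move=> U0 dU dV.
have r0 : U x ^+ 2 + V x ^+ 2 != 0.
  by rewrite gt_eqF// ltr_wpDr ?sqr_ge0 ?exprn_gt0.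
have dA := is_deriveZr p (is_derive_argument U0 dU dV).
have /is_derive_eq := is_deriveMr (is_derive_modulus p U0 dU dV)
  (is_derive_comp (is_derive_cos _) dA).
by apply; field.
Qed.

Lemma is_derive_impow p (U V : R -> R) x a b : 0 < U x ->
  is_derive x 1 U a -> is_derive x 1 V b ->
  is_derive x 1 (fun y => impow p (U y) (V y))
    (p * (U x ^+ 2 + V x ^+ 2) `^ (p / 2) / (U x ^+ 2 + V x ^+ 2) *
     ((U x * a + V x * b) * sin (p * atan (V x / U x)) +
      (U x * b - V x * a) * cos (p * atan (V x / U x)))).
Proof.
move=> U0 dU dV.
have r0 : U x ^+ 2 + V x ^+ 2 != 0.
  by rewrite gt_eqF// ltr_wpDr ?sqr_ge0 ?exprn_gt0.
have dA := is_deriveZr p (is_derive_argument U0 dU dV).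
have /is_derive_eq := is_deriveMr (is_derive_modulus p U0 dU dV)
  (is_derive_comp (is_derive_sin _) dA).
by apply; field.
Qed.

Lemma norm_repow p u v : `|repow p u v| <= (u ^+ 2 + v ^+ 2) `^ (p / 2).
Proof. by rewrite normrM ger0_norm ?powR_ge0// ler_piMr ?powR_ge0// cos_max. Qed.

Lemma norm_impow p u v : `|impow p u v| <= (u ^+ 2 + v ^+ 2) `^ (p / 2).
Proof. by rewrite normrM ger0_norm ?powR_ge0// ler_piMr ?powR_ge0// sin_max. Qed.

End riesz_inequality.

(** * Integrals against compactly supported functions, Poisson kernels *)

Section bounded_compact_support.
Context (R : realType).
Implicit Types (f g : R -> R).

(** Bounded functions with compact support. The single inequality says that f is
    bounded by M and vanishes outside [-N, N]. *)
Definition bcs f := measurable_fun [set: R] f /\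
  exists M N : R, forall x, `|f x| <= M * (`|x| <= N)%R%:R.

Lemma bcsM f g : bcs f -> measurable_fun [set: R] g ->
  (exists C, forall x, `|g x| <= C) -> bcs (fun x => f x * g x).
Proof.
move=> [mf [M [N fM]]] mg [C gC]; split; first exact: measurable_funM.
exists (M * C), N => x; rewrite normrM mulrAC; apply: ler_pM => //.
Qed.

Lemma bcs_integrable f : bcs f -> leb.-integrable [set: R] (EFin \o f).
Proof.
move=> [mf [M [N fM]]].
apply: (@le_integrable _ _ _ leb _ measurableT _
  (fun x => (M * \1_(`[- N, N]%classic : set R) x)%:E)).
- exact/measurable_EFinP.
- move=> x _ /=; rewrite lee_fin; apply: le_trans (fM x) _.
  rewrite indicE (_ : (x \in _) = (`|x| <= N)) ?ler_norm//.
  by rewrite ler_norml; apply/idP/idP; rewrite inE/= in_itv.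
- under eq_fun do rewrite EFinM.
  apply: integrableZl => //; apply: integrable_indic_itv.
Qed.

Lemma bcs_integrableM f g : bcs f -> measurable_fun [set: R] g ->
  (exists C, forall x, `|g x| <= C) ->
  leb.-integrable [set: R] (EFin \o (fun x => f x * g x)).
Proof. by move=> ? ? ?; apply: bcs_integrable; exact: bcsM. Qed.

Lemma bcs_abs f : bcs f -> bcs (fun x => `|f x|).
Proof.
move=> [mf [M [N fM]]]; split; first exact: measurableT_comp.
by exists M, N => x; rewrite normr_id.
Qed.

Lemma le_normr_bcs f g C : bcs f -> measurable_fun [set: R] g ->
  (forall x, `|g x| <= C) ->
  `|\int[leb]_x (f x * g x)| <= C * \int[leb]_x `|f x|.
Proof.
move=> bf mg gC; apply: le_trans.
  by apply: le_normr_Rintegral => //; apply: bcs_integrableM => //; exists C.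
rewrite -RintegralZl//; last exact/bcs_integrable/bcs_abs.
apply: le_Rintegral => //.
- by apply/bcs_integrable/bcs_abs/bcsM => //; exists C.
- under eq_fun do rewrite mulrC.
  by apply: (@bcs_integrableM (fun x => `|f x|) (cst C)) => //; [exact: bcs_abs|exists `|C|].
- by move=> x _; rewrite normrM mulrC ler_wpM2r.
Qed.

(** Differentiation under the integral sign; the support and the bounds on f and
    on the kernel provide the dominating function C |f|. *)
Lemma is_derive_bcs_integral f (K K' : R -> R -> R) a (u v C : R) :
  bcs f -> a \in `]u, v[ ->
  (forall z, z \in `]u, v[ -> measurable_fun [set: R] (K z)) ->
  (forall z t, z \in `]u, v[ -> `|K z t| <= C) ->
  (forall z t, z \in `]u, v[ -> is_derive z 1 (K^~ t) (K' z t)) ->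
  (forall z t, z \in `]u, v[ -> `|K' z t| <= C) ->
  is_derive a 1 (fun z => \int[leb]_t (f t * K z t)) (\int[leb]_t (f t * K' a t)).
Proof.
move=> bf auv mK bK dK bK'.
have dF z t : z \in `]u, v[ -> is_derive z 1 (fun z => f t * K z t) (f t * K' z t).
  by move=> zuv; apply: is_deriveZr; exact: dK.
have p1 z t : z \in `]u, v[ ->
    partial1of2 (fun z t => f t * K z t) z t = f t * K' z t.
  by move=> zuv; rewrite partial1of2E; apply: (@derive_val _ _ _ _ _ _ _ (dF z t zuv)).
have intf z : z \in `]u, v[ ->
    leb.-integrable [set: R] (EFin \o (fun t => f t * K z t)).
  by move=> zuv; apply: bcs_integrableM => //; [exact: mK|exists C => x; exact: bK].
have H1 : forall z t, `]u, v[%classic z -> [set: R] t -> derivable (fun z => f t * K z t) z 1.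
  by move=> z t zuv _; case: (dF z t zuv).
have G0 t : 0 <= `|f t| * `|C| by [].
have IG : leb.-integrable [set: R] (EFin \o (fun t => `|f t| * `|C|)).
  by apply: (@bcs_integrableM (fun x => `|f x|) (cst `|C|)) => //; [exact: bcs_abs|exists `|C| => ?; rewrite /= normr_id].
have Gub z t : `]u, v[%classic z -> [set: R] t ->
    `|partial1of2 (fun z t => f t * K z t) z t| <= `|f t| * `|C|.
  by move=> zuv _; rewrite p1// normrM ler_wpM2l// (le_trans (bK' _ _ zuv))// ler_norm.
have D := derivable_under_integral measurableT auv intf H1 G0 IG Gub.
have E : 'D_1 (fun z => \int[leb]_t (f t * K z t)) a = \int[leb]_t (f t * K' a t).
  rewrite -derive1E (differentiation_under_integral measurableT auv intf H1 G0 IG Gub).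
  by apply: eq_Rintegral => t _; rewrite p1.
refine (DeriveDef D E).
Qed.

Lemma continuous_bcs_integral f (K : R -> R -> R) (C : R) :
  bcs f -> (forall z, measurable_fun [set: R] (K z)) ->
  (forall z t, `|K z t| <= C) -> (forall t, continuous (K^~ t)) ->
  continuous (fun z => \int[leb]_t (f t * K z t)).
Proof.
move=> bf mK bK cK z.
have zI : z \in (`]z - 1, z + 1[%classic : set R).
  by rewrite inE/= in_itv/=; apply/andP; split; lra.
have bf' := bcs_abs bf.
apply: (@continuity_under_integral R _ _ leb (fun z t => f t * K z t) [set: R]
  measurableT (z - 1) (z + 1) _ _ (fun t => `|f t| * `|C|)) => //.
- by move=> x _; apply: bcs_integrableM => //; exists C.
- apply: aeW => t _ x _; apply: cvgM; [exact: cvg_cst|exact: cK].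
- by apply: (@bcs_integrableM (fun x => `|f x|) (cst `|C|)) => //; exists `|C| => ?; rewrite /= normr_id.
- move=> x _; apply: aeW => t _; rewrite normrM ler_wpM2l//.
  by rewrite (le_trans (bK _ _))// ler_norm.
Qed.

End bounded_compact_support.

Section poisson_kernels.
Context {R : realType}.
Implicit Types (s t x y : R).

(** The Poisson kernel of the upper half-plane, without the factor 1 / pi; the
    next function is its conjugate. *)
Definition pker s y : R := y / (s ^+ 2 + y ^+ 2).
Definition qker s y : R := s / (s ^+ 2 + y ^+ 2).
(** The partial derivative of the Poisson kernel in y, which is also the
    opposite of that of the conjugate kernel in s. *)
Definition pker' s y : R := (s ^+ 2 - y ^+ 2) / (s ^+ 2 + y ^+ 2) ^+ 2.
(** The partial derivative of the Poisson kernel in s, which is also that of the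
    conjugate kernel in y. *)
Definition qker' s y : R := - (2 * s * y) / (s ^+ 2 + y ^+ 2) ^+ 2.

Lemma sqD_gt0 s y : 0 < y -> 0 < s ^+ 2 + y ^+ 2.
Proof. by move=> y0; rewrite ltr_wpDl ?sqr_ge0 ?exprn_gt0. Qed.

Section derivatives.
Variables (s y : R).
Hypothesis y0 : 0 < y.

Let D0 : s ^+ 2 + y ^+ 2 != 0. Proof. by rewrite gt_eqF ?sqD_gt0. Qed.

Let dD1 : is_derive s 1 (fun s => s ^+ 2 + y ^+ 2) (2 * s).
Proof.
have i := is_derive_idr s.
have /is_derive_eq := is_deriveDr (is_deriveMr i i) (is_derive_cstr s (y ^+ 2)).
by apply; ring.
Qed.

Let dD2 : is_derive y 1 (fun y => s ^+ 2 + y ^+ 2) (2 * y).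
Proof.
have i := is_derive_idr y.
have /is_derive_eq := is_deriveDr (is_derive_cstr y (s ^+ 2)) (is_deriveMr i i).
by apply; ring.
Qed.

Lemma is_derive_pker1 : is_derive s 1 (pker ^~ y) (qker' s y).
Proof.
have /is_derive_eq := is_deriveZr y (@is_deriveVr R (fun s => s ^+ 2 + y ^+ 2) s _ D0 dD1).
by apply; rewrite /qker'; field.
Qed.

Lemma is_derive_qker1 : is_derive s 1 (qker ^~ y) (- pker' s y).
Proof.
have /is_derive_eq := is_deriveMr (is_derive_idr s) (@is_deriveVr R (fun s => s ^+ 2 + y ^+ 2) s _ D0 dD1).
by apply; rewrite /pker'; field.
Qed.

Lemma is_derive_pker2 : is_derive y 1 (pker s) (pker' s y).
Proof.
have /is_derive_eq := is_deriveMr (is_derive_idr y) (@is_deriveVr R (fun y => s ^+ 2 + y ^+ 2) y _ D0 dD2).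
by apply; rewrite /pker'; field.
Qed.

Lemma is_derive_qker2 : is_derive y 1 (qker s) (qker' s y).
Proof.
have /is_derive_eq := is_deriveZr s (@is_deriveVr R (fun y => s ^+ 2 + y ^+ 2) y _ D0 dD2).
by apply; rewrite /qker'; field.
Qed.

End derivatives.

Section bounds.
Variables (s y : R).
Hypothesis y12 : 2^-1 < y.

Let bnd : [/\ 2^-1 < y, 1 < 4 * y ^+ 2 & 1 < 4 * (s ^+ 2 + y ^+ 2)].
Proof.
have h : 2^-1 < y := y12; have h1 : 1 < 4 * y ^+ 2 by nra.
by split => //; have := sqr_ge0 s; lra.
Qed.

Lemma pker_le : `|pker s y| <= 4.
Proof.
have [h yy D0] := bnd.
have ss := sqr_ge0 s; have y1 : y < 2 * y ^+ 2 by nra.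
rewrite /pker ger0_norm; last by rewrite divr_ge0 ?addr_ge0 ?sqr_ge0//; lra.
by rewrite ler_pdivrMr; lra.
Qed.

Lemma qker_le : `|qker s y| <= 4.
Proof.
have [h yy D0] := bnd.
have D1 : 0 < s ^+ 2 + y ^+ 2 by lra.
have := sqr_ge0 (s - 2^-1); have := sqr_ge0 (s + 2^-1).
rewrite /qker normrM normfV (gtr0_norm D1) ler_pdivrMr// ler_norml => h1 h2.
by apply/andP; split; lra.
Qed.

Lemma pker'_le : `|pker' s y| <= 4.
Proof.
have [h yy D0] := bnd.
have D1 : 0 < (s ^+ 2 + y ^+ 2) ^+ 2 by rewrite exprn_gt0//; lra.
have ss := sqr_ge0 s; have ss' := sqr_ge0 y.
have H : s ^+ 2 + y ^+ 2 <= 4 * (s ^+ 2 + y ^+ 2) ^+ 2.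
  by rewrite expr2 mulrA ler_peMl; lra.
rewrite /pker' normrM normfV (gtr0_norm D1) ler_pdivrMr// ler_norml.
by apply/andP; split; lra.
Qed.

Lemma qker'_le : `|qker' s y| <= 4.
Proof.
have [h yy D0] := bnd.
have D1 : 0 < (s ^+ 2 + y ^+ 2) ^+ 2 by rewrite exprn_gt0//; lra.
have H : s ^+ 2 + y ^+ 2 <= 4 * (s ^+ 2 + y ^+ 2) ^+ 2.
  by rewrite expr2 mulrA ler_peMl; lra.
have := sqr_ge0 (s - y); have := sqr_ge0 (s + y).
rewrite /qker' normrM normfV (gtr0_norm D1) ler_pdivrMr// ler_norml => h1 h2.
by apply/andP; split; lra.
Qed.

End bounds.

Lemma continuous_kernel_quotient (P : R -> R) y n : 0 < y -> continuous P ->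
  continuous (fun s => P s / (s ^+ 2 + y ^+ 2) ^+ n).
Proof.
move=> y0 cP s; apply: cvgM; first exact: cP.
apply: cvgV; first by rewrite expf_neq0// gt_eqF ?sqD_gt0.
apply: (@continuous_comp _ _ _ (fun s : R => s ^+ 2 + y ^+ 2) (fun z : R => z ^+ n)).
  by apply: cvgD; [exact: exprn_continuous|exact: cvg_cst].
exact: exprn_continuous.
Qed.

Lemma continuous_pker y : 0 < y -> continuous (pker ^~ y).
Proof. by move=> y0; apply: (@continuous_kernel_quotient (cst y) y 1) => // s; exact: cvg_cst. Qed.

Lemma continuous_qker y : 0 < y -> continuous (qker ^~ y).
Proof. by move=> y0; apply: (@continuous_kernel_quotient id y 1) => // s; exact: cvg_id. Qed.

Lemma continuous_pker' y : 0 < y -> continuous (pker' ^~ y).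
Proof.
move=> y0; apply: (@continuous_kernel_quotient (fun s => s ^+ 2 - y ^+ 2)) => // s.
by apply: cvgB; [exact: exprn_continuous|exact: cvg_cst].
Qed.

Lemma continuous_qker' y : 0 < y -> continuous (qker' ^~ y).
Proof.
move=> y0; apply: (@continuous_kernel_quotient (fun s => - (2 * s * y))) => // s.
apply: cvgN; apply: cvgM; last exact: cvg_cst.
by apply: cvgM; [exact: cvg_cst|exact: cvg_id].
Qed.

End poisson_kernels.

(** * The holomorphic extension to the upper half-plane *)

Section harmonic_extension.
Context (R : realType).
Variable f : R -> R.
Hypothesis bf : bcs f.
Hypothesis f0 : forall x, 0 <= f x.
Let m := \int[leb]_x (f x).
Hypothesis m0 : 0 < m.
Implicit Types (x y : R).

(** Together, pext + i qext is the holomorphic function i int f(t) / (z - t) dt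
    at z = x + i y: for f >= 0 it maps the upper half-plane to the right
    half-plane, and its height-one trace qext is the conjugate Poisson integral
    that has to be estimated. *)
Definition pext x y := \int[leb]_t (f t * pker (x - t) y).
Definition qext x y := \int[leb]_t (f t * qker (x - t) y).
Definition pext' x y := \int[leb]_t (f t * pker' (x - t) y).
Definition qext' x y := \int[leb]_t (f t * qker' (x - t) y).

Lemma continuous_subx (K : R -> R) x : continuous K -> continuous (fun t => K (x - t)).
Proof.
move=> cK t; apply: (@continuous_comp _ _ _ (fun t => x - t) K); last exact: cK.
by apply: cvgB; [exact: cvg_cst|exact: cvg_id].
Qed.

Lemma measurable_subx (K : R -> R) x : continuous K ->
  measurable_fun [set: R] (fun t => K (x - t)).
Proof. by move=> cK; apply: continuous_measurable_fun; exact: continuous_subx. Qed.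

Lemma is_derive_subx (K : R -> R) x t a : is_derive (x - t) 1 K a ->
  is_derive x 1 (fun x => K (x - t)) a.
Proof.
move=> dK.
have /is_derive_eq := @is_derive_comp R K (fun x => x - t) x _ _ dK (is_deriveBr (is_derive_idr x) (is_derive_cstr x t)).
by apply; rewrite subr0 mulr1.
Qed.

Let half_gt0 y : 2^-1 < y -> 0 < y. Proof. by move=> h; lra. Qed.

Lemma is_derive_pext1 x y : 2^-1 < y -> is_derive x 1 (pext ^~ y) (qext' x y).
Proof.
move=> y0; have y1 := half_gt0 y0.
apply: (@is_derive_bcs_integral R f (fun x t => pker (x - t) y)
  (fun x t => qker' (x - t) y) x (x - 1) (x + 1) 4 bf).
- by rewrite in_itv/=; apply/andP; split; lra.
- by move=> z _; apply: (measurable_subx (K := pker ^~ y)); exact: continuous_pker.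
- by move=> z t _; exact: pker_le.
- by move=> z t _; apply: (is_derive_subx (K := pker ^~ y)); exact: is_derive_pker1.
- by move=> z t _; exact: qker'_le.
Qed.

Lemma is_derive_qext1 x y : 2^-1 < y -> is_derive x 1 (qext ^~ y) (- pext' x y).
Proof.
move=> y0; have y1 := half_gt0 y0.
have -> : - pext' x y = \int[leb]_t (f t * - pker' (x - t) y).
  rewrite -mulN1r -RintegralZl//.
    by apply: eq_Rintegral => t _; rewrite mulN1r mulrN.
  apply: bcs_integrableM => //; last by exists 4 => t; exact: pker'_le.
  by apply: (measurable_subx (K := pker' ^~ y)); exact: continuous_pker'.
apply: (@is_derive_bcs_integral R f (fun x t => qker (x - t) y)
  (fun x t => - pker' (x - t) y) x (x - 1) (x + 1) 4 bf).
- by rewrite in_itv/=; apply/andP; split; lra.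
- by move=> z _; apply: (measurable_subx (K := qker ^~ y)); exact: continuous_qker.
- by move=> z t _; exact: qker_le.
- by move=> z t _; apply: (is_derive_subx (K := qker ^~ y)); exact: is_derive_qker1.
- by move=> z t _; rewrite normrN; exact: pker'_le.
Qed.

Lemma is_derive_pext2 x y : 2^-1 < y -> is_derive y 1 (pext x) (pext' x y).
Proof.
move=> y0; have y1 := half_gt0 y0.
have H z : z \in `]2^-1, y + 1[ -> 2^-1 < z by rewrite in_itv/= => /andP[].
apply: (@is_derive_bcs_integral R f (fun y t => pker (x - t) y)
  (fun y t => pker' (x - t) y) y 2^-1 (y + 1) 4 bf).
- by rewrite in_itv/=; apply/andP; split; lra.
- by move=> z /H/half_gt0 z0; apply: (measurable_subx (K := pker ^~ z)); exact: continuous_pker.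
- by move=> z t /H z0; exact: pker_le.
- by move=> z t /H/half_gt0 z0; exact: is_derive_pker2.
- by move=> z t /H z0; exact: pker'_le.
Qed.

Lemma is_derive_qext2 x y : 2^-1 < y -> is_derive y 1 (qext x) (qext' x y).
Proof.
move=> y0; have y1 := half_gt0 y0.
have H z : z \in `]2^-1, y + 1[ -> 2^-1 < z by rewrite in_itv/= => /andP[].
apply: (@is_derive_bcs_integral R f (fun y t => qker (x - t) y)
  (fun y t => qker' (x - t) y) y 2^-1 (y + 1) 4 bf).
- by rewrite in_itv/=; apply/andP; split; lra.
- by move=> z /H/half_gt0 z0; apply: (measurable_subx (K := qker ^~ z)); exact: continuous_qker.
- by move=> z t /H z0; exact: qker_le.
- by move=> z t /H/half_gt0 z0; exact: is_derive_qker2.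
- by move=> z t /H z0; exact: qker'_le.
Qed.

Let subC (K : R -> R) t : continuous K -> continuous (fun x => K (x - t)).
Proof.
move=> cK x; apply: (@continuous_comp _ _ _ (fun x => x - t) K); last exact: cK.
by apply: cvgB; [exact: cvg_id|exact: cvg_cst].
Qed.

Lemma continuous_pext' y : 2^-1 < y -> continuous (pext' ^~ y).
Proof.
move=> y0; have y1 := half_gt0 y0.
apply: (@continuous_bcs_integral R f (fun x t => pker' (x - t) y) 4) => //.
- by move=> z; apply: (measurable_subx (K := pker' ^~ y)); exact: continuous_pker'.
- by move=> z t; exact: pker'_le.
- by move=> t; apply: (subC (K := pker' ^~ y)); exact: continuous_pker'.
Qed.

Lemma continuous_qext' y : 2^-1 < y -> continuous (qext' ^~ y).
Proof.
move=> y0; have y1 := half_gt0 y0.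
apply: (@continuous_bcs_integral R f (fun x t => qker' (x - t) y) 4) => //.
- by move=> z; apply: (measurable_subx (K := qker' ^~ y)); exact: continuous_qker'.
- by move=> z t; exact: qker'_le.
- by move=> t; apply: (subC (K := qker' ^~ y)); exact: continuous_qker'.
Qed.

Let mE : \int[leb]_x `|f x| = m.
Proof. by apply: eq_Rintegral => x _; rewrite ger0_norm. Qed.

Lemma norm_ext_le x y : 2^-1 < y ->
  [/\ `|pext x y| <= 4 * m, `|qext x y| <= 4 * m, `|pext' x y| <= 4 * m & `|qext' x y| <= 4 * m].
Proof.
move=> y0; have y1 := half_gt0 y0; rewrite -mE.
split; apply: le_normr_bcs => //.
- by apply: (measurable_subx (K := pker ^~ y)); exact: continuous_pker.
- by move=> t; exact: pker_le.
- by apply: (measurable_subx (K := qker ^~ y)); exact: continuous_qker.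
- by move=> t; exact: qker_le.
- by apply: (measurable_subx (K := pker' ^~ y)); exact: continuous_pker'.
- by move=> t; exact: pker'_le.
- by apply: (measurable_subx (K := qker' ^~ y)); exact: continuous_qker'.
- by move=> t; exact: qker'_le.
Qed.

(** On the support of f the Poisson kernel stays above a positive constant. *)
Lemma pext_gt0 x y : 2^-1 < y -> 0 < pext x y.
Proof.
move=> y0; have y1 := half_gt0 y0.
have [mf [M [N fM]]] := bf.
pose c := y / ((`|x| + `|N|) ^+ 2 + y ^+ 2).
have c0 : 0 < c by rewrite divr_gt0// sqD_gt0.
apply: (@lt_le_trans _ _ (c * m)); first by rewrite mulr_gt0.
rewrite -RintegralZl//; last exact: bcs_integrable.
apply: le_Rintegral => //.
- under eq_fun do rewrite mulrC.
  by apply: (bcs_integrableM (g := cst c)) => //; exists `|c|.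
- apply: bcs_integrableM => //; last by exists 4 => t; exact: pker_le.
  by apply: (measurable_subx (K := pker ^~ y)); exact: continuous_pker.
- move=> t _; rewrite mulrC.
  have [tN|tN] := leP `|t| N; last first.
    have := fM t; rewrite (leNgt `|t| N) tN /= mulr0 normr_le0 => /eqP ->.
    by rewrite !mul0r.
  apply: ler_wpM2l => //.
  rewrite /c /pker ler_pM2l// lef_pV2 ?posrE ?sqD_gt0// lerD2r.
  rewrite -[leLHS]real_normK ?num_real//.
  have : `|x - t| <= `|x| + `|N|.
    by rewrite (le_trans (ler_normB _ _))// lerD2l (le_trans tN)// ler_norm.
  by apply: lerXn2r; rewrite nnegrE// addr_ge0.
Qed.

(** At distance |x| + y from the origin the kernels are of size 1 / (|x| + y) on
    the support of f, up to a factor which depends on the support. *)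
Lemma ext_decay : exists2 E : R, 0 < E & forall x y, 1 <= y ->
  `|pext x y| <= E / (`|x| + y) /\ `|qext x y| <= E / (`|x| + y).
Proof.
have [mf [M [N fM]]] := bf.
exists ((`|N| + 2) * m); first by rewrite mulr_gt0// ltr_wpDl.
move=> x y y1; have y0 : 2^-1 < y by lra.
have yp := half_gt0 y0.
have xy0 : 0 < `|x| + y by rewrite ltr_wpDl.
have key (K : R -> R) : continuous K -> (exists C, forall t, `|K t| <= C) ->
    (forall t, `|t| <= N -> `|K (x - t)| <= (`|N| + 2) / (`|x| + y)) ->
    `|\int[leb]_t (f t * K (x - t))| <= (`|N| + 2) * m / (`|x| + y).
  move=> cK [C bK] KN; have mK := measurable_subx x cK.
  have intK : leb.-integrable [set: R] (EFin \o (fun t => f t * K (x - t))).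
    by apply: bcs_integrableM => //; exists C.
  apply: le_trans; first exact: le_normr_Rintegral.
  rewrite mulrAC -RintegralZl//; last exact: bcs_integrable.
  apply: le_Rintegral => //.
  - by apply/bcs_integrable/bcs_abs/bcsM => //; exists C.
  - under eq_fun do rewrite mulrC.
    apply: (bcs_integrableM (g := cst ((`|N| + 2) / (`|x| + y)))) => //.
    by exists `|(`|N| + 2) / (`|x| + y)|.
  - move=> t _; rewrite normrM (ger0_norm (f0 t)) mulrC.
    have [tN|tN] := leP `|t| N; last first.
      have := fM t; rewrite (leNgt `|t| N) tN /= mulr0 normr_le0 => /eqP ->.
      by rewrite !mulr0.
    by rewrite ler_wpM2r// KN.
have xE t : `|t| <= N -> `|x| <= `|x - t| + `|N|.
  move=> tN; have := ler_normD (x - t) t; rewrite subrK => /le_trans; apply.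
  by rewrite lerD2l (le_trans tN)// ler_norm.
have N0 : 0 <= `|N| by [].
split; [apply: (key (pker ^~ y))|apply: (key (qker ^~ y))].
- exact: continuous_pker.
- by exists 4 => t; exact: pker_le.
- move=> t /xE xs; have s0 := sqD_gt0 (x - t) yp.
  rewrite /pker normrM normfV (gtr0_norm yp) (gtr0_norm s0).
  rewrite ler_pdivrMr// mulrAC ler_pdivlMr//.
  rewrite -(real_normK (num_real (x - t))).
  set s := `|x - t| in xs *; set n := `|N| in xs N0 *.
  have s1 : 0 <= s by exact: normr_ge0.
  have := sqr_ge0 (s - y).
  have : y * (`|x| + y) <= y * (s + n + y) by rewrite ler_pM2l//; lra.
  have : y * n <= y ^+ 2 * n by rewrite ler_wpM2r// expr2 ler_peMr// ltW.
  have : 0 <= n * s ^+ 2 by rewrite mulr_ge0 ?sqr_ge0.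
  have := sqr_ge0 s; have := sqr_ge0 y.
  lra.
- exact: continuous_qker.
- by exists 4 => t; exact: qker_le.
- move=> t /xE xs; have s0 := sqD_gt0 (x - t) yp.
  rewrite /qker normrM normfV (gtr0_norm s0).
  rewrite ler_pdivrMr// mulrAC ler_pdivlMr//.
  rewrite -(real_normK (num_real (x - t))).
  set s := `|x - t| in xs *; set n := `|N| in xs N0 *.
  have s1 : 0 <= s by exact: normr_ge0.
  have := sqr_ge0 (s - y).
  have : s * (`|x| + y) <= s * (s + n + y) by rewrite ler_wpM2l//; lra.
  have : s * n <= s * y * n by rewrite ler_wpM2r// ler_peMr.
  have : s * y * n <= (s ^+ 2 + y ^+ 2) * n.
    rewrite ler_wpM2r//; have := sqr_ge0 (s - y); have := sqr_ge0 (s + y); lra.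
  have := sqr_ge0 s; have := sqr_ge0 y.
  lra.
Qed.

End harmonic_extension.

(** * Shifting the line of integration *)

Section contour_shift.
Context (R : realType).
Variable f : R -> R.
Hypothesis bf : bcs f.
Hypothesis f0 : forall x, 0 <= f x.
Let m := \int[leb]_x (f x).
Hypothesis m0 : 0 < m.
Variable p : R.
Hypothesis p1 : 1 < p.
Implicit Types (x y X : R).

Local Notation U := (pext f).
Local Notation V := (qext f).
Let h x y := repow p (U x y) (V x y).
Let k x y := impow p (U x y) (V x y).
Let r2 x y := U x y ^+ 2 + V x y ^+ 2.
Let h' x y := p * r2 x y `^ (p / 2) / r2 x y *
  ((U x y * pext' f x y + V x y * qext' f x y) * cos (p * atan (V x y / U x y)) -
   (U x y * qext' f x y - V x y * pext' f x y) * sin (p * atan (V x y / U x y))).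

Let r2_gt0 x y : 2^-1 < y -> 0 < r2 x y.
Proof.
by move=> y0; rewrite /r2 ltr_wpDr ?sqr_ge0// exprn_gt0// pext_gt0.
Qed.

Let is_derive_h x y : 2^-1 < y -> is_derive y 1 (h x) (h' x y).
Proof.
move=> y0; apply: is_derive_repow; first exact: pext_gt0.
  exact: is_derive_pext2.
exact: is_derive_qext2.
Qed.

Let is_derive_k x y : 2^-1 < y -> is_derive x 1 (k ^~ y) (- h' x y).
Proof.
move=> y0; have /is_derive_eq := @is_derive_impow R p (U ^~ y) (V ^~ y) x _ _
  (pext_gt0 bf f0 m0 x y0) (is_derive_pext1 bf x y0) (is_derive_qext1 bf x y0).
by apply; rewrite /h' -/(r2 x y); ring.
Qed.

Let continuous_U y : 2^-1 < y -> continuous (U ^~ y).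
Proof. by move=> y0 x; exact: is_derive_continuous (is_derive_pext1 bf x y0). Qed.

Let continuous_V y : 2^-1 < y -> continuous (V ^~ y).
Proof. by move=> y0 x; exact: is_derive_continuous (is_derive_qext1 bf x y0). Qed.

Let continuous_r2 y : 2^-1 < y -> continuous (r2 ^~ y).
Proof.
move=> y0 x; apply: cvgD.
  by apply: (@continuous_comp _ _ _ (U ^~ y) (fun z => z ^+ 2));
    [exact: continuous_U|exact: exprn_continuous].
by apply: (@continuous_comp _ _ _ (V ^~ y) (fun z => z ^+ 2));
    [exact: continuous_V|exact: exprn_continuous].
Qed.

Let continuous_mod y : 2^-1 < y -> continuous (fun x => r2 x y `^ (p / 2)).
Proof.
move=> y0 x; apply: (@continuous_comp _ _ _ (r2 ^~ y) (fun z => z `^ (p / 2))).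
  exact: continuous_r2.
exact: is_derive_continuous (is_derive1_powR (p / 2) (r2_gt0 x y0)).
Qed.

Let continuous_arg y : 2^-1 < y -> continuous (fun x => p * atan (V x y / U x y)).
Proof.
move=> y0 x; apply: cvgM; first exact: cvg_cst.
apply: (@continuous_comp _ _ _ (fun x => V x y / U x y) atan); last exact: continuous_atan.
apply: cvgM; first exact: continuous_V.
by apply: cvgV; [rewrite gt_eqF// pext_gt0|exact: continuous_U].
Qed.

Let continuous_cosarg y : 2^-1 < y -> continuous (fun x => cos (p * atan (V x y / U x y))).
Proof.
move=> y0 x; apply: (@continuous_comp _ _ _ (fun x => p * atan (V x y / U x y)) cos).
  exact: continuous_arg.
exact: continuous_cos.
Qed.

Let continuous_sinarg y : 2^-1 < y -> continuous (fun x => sin (p * atan (V x y / U x y))).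
Proof.
move=> y0 x; apply: (@continuous_comp _ _ _ (fun x => p * atan (V x y / U x y)) sin).
  exact: continuous_arg.
exact: continuous_sin.
Qed.

Let continuous_h y : 2^-1 < y -> continuous (h ^~ y).
Proof.
move=> y0 x; apply: cvgM; first exact: continuous_mod.
exact: continuous_cosarg.
Qed.

Let continuous_h' y : 2^-1 < y -> continuous (h' ^~ y).
Proof.
move=> y0 x; have cU := @continuous_U _ y0 x; have cV := @continuous_V _ y0 x.
have ca := @continuous_pext' _ _ bf _ y0 x; have cb := @continuous_qext' _ _ bf _ y0 x.
apply: cvgM.
  apply: cvgM; last by apply: cvgV; [rewrite gt_eqF// r2_gt0|exact: continuous_r2].
  by apply: cvgM; [exact: cvg_cst|exact: continuous_mod].
apply: cvgB.
  by apply: cvgM; [apply: cvgD; apply: cvgM|exact: continuous_cosarg].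
by apply: cvgM; [apply: cvgB; apply: cvgM|exact: continuous_sinarg].
Qed.

(** With G = U + i V, h' is bounded by p |G|^(p-1) |G'| up to a constant; as p -
    1 > 0 this is uniform even where G is small, that is, far away. *)
Let h'_le : exists C : R, forall x y, 2^-1 < y -> `|h' x y| <= C.
Proof.
exists (p * (32 * m ^+ 2) `^ ((p - 1) / 2) * (16 * m)) => x y y0.
have [bU bV bu bv] := norm_ext_le bf f0 x y0.
have r20 := r2_gt0 x y0.
pose s := Num.sqrt (r2 x y).
have s0 : 0 < s by rewrite sqrtr_gt0.
have s2 : s ^+ 2 = r2 x y by rewrite sqr_sqrtr ?ltW.
have Us : `|U x y| <= s.
  by rewrite -sqrtr_sqr ler_wsqrtr// lerDl sqr_ge0.
have Vs : `|V x y| <= s.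
  by rewrite -sqrtr_sqr ler_wsqrtr// lerDr sqr_ge0.
have rm : r2 x y <= 32 * m ^+ 2.
  have q z : `|z| <= 4 * m -> z ^+ 2 <= (4 * m) ^+ 2.
    move=> zm; rewrite -(real_normK (num_real z)).
    by apply: lerXn2r; rewrite ?nnegrE// mulr_ge0// ltW.
  by have := lerD (q _ bU) (q _ bV); rewrite -/(r2 x y); lra.
have sp : r2 x y `^ (p / 2) / r2 x y * s = r2 x y `^ ((p - 1) / 2).
  rewrite /s -powR12_sqrt ?ltW// -[(r2 x y)^-1]powR_inv1 ?ltW//.
  rewrite -!powRD; try by rewrite (gt_eqF r20) implybT.
  by congr (_ `^ _); lra.
have sple : r2 x y `^ ((p - 1) / 2) <= (32 * m ^+ 2) `^ ((p - 1) / 2).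
  apply: ge0_ler_powR; rewrite ?nnegrE//; first by have : 1 < p := p1; lra.
    exact: ltW.
  by rewrite mulr_ge0// sqr_ge0.
have : `|(U x y * pext' f x y + V x y * qext' f x y) * cos (p * atan (V x y / U x y)) -
   (U x y * qext' f x y - V x y * pext' f x y) * sin (p * atan (V x y / U x y))| <= s * (16 * m).
  have prod a b : `|a| <= s -> `|b| <= 4 * m -> `|a * b| <= s * (4 * m).
    by move=> ? ?; rewrite normrM ler_pM.
  apply: le_trans (ler_normB _ _) _; rewrite !normrM.
  have c1 := cos_max (p * atan (V x y / U x y)).
  have c2 := sin_max (p * atan (V x y / U x y)).
  have -> : s * (16 * m) = (s * (4 * m) + s * (4 * m)) * 1 + (s * (4 * m) + s * (4 * m)) * 1.
    by ring.
  apply: lerD; apply: ler_pM => //.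
    by apply: le_trans (ler_normD _ _) _; apply: lerD; exact: prod.
  by apply: le_trans (ler_normB _ _) _; apply: lerD; exact: prod.
move=> H; rewrite /h' normrM.
have p0 : 0 < p by exact: lt_trans ltr01 p1.
have A0 : 0 <= p * r2 x y `^ (p / 2) / r2 x y.
  by rewrite divr_ge0 ?mulr_ge0 ?powR_ge0// ltW.
rewrite (ger0_norm A0); apply: le_trans (ler_wpM2l A0 H) _.
have assoc (a b c d e : R) : a * b / c * (d * e) = a * (b / c * d) * e.
  by rewrite !mulrA.
by rewrite assoc sp ler_wpM2r ?mulr_ge0 ?ler_pM2l// ltW.
Qed.

Let I X y := \int[leb]_(x in `[- X, X]) h x y.

Let continuous_integrable (g : R -> R) X : continuous g ->
  leb.-integrable `[- X, X] (EFin \o g).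
Proof.
move=> cg; apply: continuous_compact_integrable; first exact: segment_compact.
exact: continuous_subspaceT.
Qed.

(** With h + i k = G^p, the Cauchy-Riemann equation d h / d y = - d k / d x
    turns the derivative of the integral of h over [-X, X] into boundary values
    of k. *)
Let is_derive_I X y : 0 < X -> 2^-1 < y ->
  is_derive y 1 (I X) (k (- X) y - k X y).
Proof.
move=> X0 y0; have [C hC] := h'_le.
have p1h x z : 2^-1 < z -> partial1of2 (fun z x => h x z) z x = h' x z.
  by move=> z0; rewrite partial1of2E; apply: (@derive_val _ _ _ _ _ _ _ (is_derive_h x z0)).
have Hz z : z \in `]2^-1, y + 1[ -> 2^-1 < z by rewrite in_itv/= => /andP[].
have yI : `]2^-1, y + 1[%classic y by rewrite /= in_itv/=; apply/andP; split; lra.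
have mX : measurable (`[- X, X]%classic : set (measurableTypeR R)) by exact: measurable_itv.
have H1 z : `]2^-1, y + 1[%classic z ->
    leb.-integrable `[- X, X] (EFin \o (fun x => h x z)).
  by move=> /Hz z0; apply: continuous_integrable; exact: continuous_h.
have H2 z x : `]2^-1, y + 1[%classic z -> `[- X, X]%classic x ->
    derivable (fun z => h x z) z 1.
  by move=> /Hz z0 _; case: (is_derive_h x z0).
have C0 : 0 <= C by exact: le_trans (hC 0 y y0).
have H3 : leb.-integrable `[- X, X] (EFin \o (cst C : R -> R)).
  by apply: continuous_integrable => x; exact: cvg_cst.
have H4 z x : `]2^-1, y + 1[%classic z -> `[- X, X]%classic x ->
    `|partial1of2 (fun z x => h x z) z x| <= C.
  by move=> /Hz z0 _; rewrite p1h// hC.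
have D := derivable_under_integral (mu := leb) (f := fun z x => h x z) mX yI H1 H2 (fun=> C0) H3 H4.
have E : 'D_1 (I X) y = k (- X) y - k X y.
  rewrite -derive1E (differentiation_under_integral (mu := leb) (f := fun z x => h x z) mX yI H1 H2 (fun=> C0) H3 H4).
  transitivity (\int[leb]_(x in `[- X, X]) (h' x y)).
    by apply: eq_Rintegral => x _; rewrite p1h.
  have kd x : is_derive x 1 (fun x => - k x y) (h' x y).
    have -> : (fun x => - k x y) = (fun x => -1 * k x y).
      by apply/funext => z; rewrite mulN1r.
    have /is_derive_eq := @is_deriveZr R (k ^~ y) (-1) x _ (is_derive_k x y0).
    by apply; rewrite mulN1r opprK.
  rewrite /Rintegral (@continuous_FTC2 _ (h' ^~ y) (fun x => - k x y)).
  - by rewrite -EFinB /= opprK addrC.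
  - by lra.
  - by apply: continuous_subspaceT; exact: continuous_h'.
  - split.
    + by move=> x _; case: (kd x).
    + by apply: cvg_at_right_filter; exact: is_derive_continuous (kd _).
    + by apply: cvg_at_left_filter; exact: is_derive_continuous (kd _).
  - by move=> x _; rewrite derive1E; apply: (@derive_val _ _ _ _ _ _ _ (kd x)).
exact: (DeriveDef D E).
Qed.

(** Cauchy's theorem for G^p on the rectangle with vertices -X + i, X + i, X + i
    X, -X + i X: on its three upper sides |G^p| = O(X^(-p)), and their total
    length is O(X). As p > 1 the integral over the lower side tends to 0. *)
Lemma integral_repow_decay : exists E : R, forall X, 1 < X ->
  `|\int[leb]_(x in `[- X, X]) repow p (U x 1) (V x 1)| <= E * X `^ (1 - p).
Proof.
have p0 : 0 < p by exact: lt_trans ltr01 p1.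
have [C C0 UV] := ext_decay bf f0 m0.
pose F := (2 * C ^+ 2) `^ (p / 2).
have F0 : 0 <= F by exact: powR_ge0.
exists (4 * F) => X X1.
have X0 : 0 < X by lra.
have XP : 0 <= X `^ (- p) by exact: powR_ge0.
have r2X x y : 1 <= y -> X <= `|x| + y -> r2 x y `^ (p / 2) <= F * X `^ (- p).
  move=> y1 xy; have [bU bV] := UV x y y1.
  have xy0 : 0 < `|x| + y by lra.
  have q z : `|z| <= C / (`|x| + y) -> z ^+ 2 <= (C / X) ^+ 2.
    move=> zC; rewrite -(real_normK (num_real z)).
    apply: lerXn2r; rewrite ?nnegrE ?divr_ge0 ?(ltW C0) ?(ltW X0)//.
    by apply: le_trans zC _; rewrite ler_pM2l// lef_pV2.
  have y12 : 2^-1 < y by lra.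
  have : r2 x y <= 2 * C ^+ 2 * X ^- 2.
    have := lerD (q _ bU) (q _ bV); rewrite -/(r2 x y) expr_div_n; lra.
  move=> H; apply: (@le_trans _ _ ((2 * C ^+ 2 * X ^- 2) `^ (p / 2))).
    apply: ge0_ler_powR; rewrite ?nnegrE//; first by lra.
      by rewrite ltW// r2_gt0.
    by rewrite mulr_ge0 ?invr_ge0 ?sqr_ge0// mulr_ge0// sqr_ge0.
  rewrite powRM ?mulr_ge0 ?invr_ge0 ?sqr_ge0 ?(ltW C0)// -/F.
  rewrite -(powR_invn 2 (ltW X0)) -powRrM.
  have -> : - 2%:R * (p / 2) = - p by field.
  exact: lexx.
have kX x y : `|x| = X -> 1 <= y -> `|k x y| <= F * X `^ (- p).
  move=> xX y1; apply: le_trans (norm_impow _ _ _) _; apply: r2X => //.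
  by rewrite xX; lra.
have IX : `|I X X| <= 2 * X * (F * X `^ (- p)).
  have ih : leb.-integrable `[- X, X] (EFin \o (fun x => h x X)).
    by apply: continuous_integrable; apply: continuous_h; lra.
  apply: le_trans; first exact: le_normr_Rintegral.
  have XX : 2 * X * (F * X `^ (- p)) = \int[leb]_(x in `[- X, X]) (F * X `^ (- p)).
    rewrite Rintegral_cst// mulrC; congr (_ * _); apply/esym.
    have /(congr1 fine) := lebesgue_measure_itv `[- X, X].
    rewrite /= lte_fin ifT; last by lra.
    by rewrite -EFinB /= => ->; ring.
  rewrite XX; apply: le_Rintegral => //.
  - exact: integrable_norm.
  - by apply: continuous_integrable => x; exact: cvg_cst.
  - move=> x _; apply: le_trans (norm_repow _ _ _) _; apply: r2X; first by lra.
    by rewrite lerDr.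
(* the height X of the rectangle is its half-width *)
have [c c1X cE] : exists2 c, c \in `]1, X[ & I X X - I X 1 = (k (- X) c - k X c) * (X - 1).
  apply: (@MVT _ (I X) (fun y => k (- X) y - k X y)) => //.
  - by move=> y; rewrite in_itv/= => /andP[y1 _]; apply: is_derive_I; lra.
  - apply: derivable_within_continuous => y; rewrite in_itv/= => /andP[y1 _].
    by have [] : is_derive y 1 (I X) (k (- X) y - k X y) by apply: is_derive_I; lra.
have c1 : 1 <= c by move: c1X; rewrite in_itv/= => /andP[/ltW].
rewrite -[X in `|X|]/(I X 1).
have -> : I X 1 = I X X - (k (- X) c - k X c) * (X - 1) by rewrite -cE subKr.
have k1 : `|k X c| <= F * X `^ (- p) by apply: kX => //; rewrite gtr0_norm.
have k2 : `|k (- X) c| <= F * X `^ (- p) by apply: kX => //; rewrite normrN gtr0_norm.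
apply: le_trans (ler_normB _ _) _.
have -> : X `^ (1 - p) = X * X `^ (- p).
  by rewrite powRD ?powRr1 ?ltW// (gt_eqF X0) implybT.
have : `|(k (- X) c - k X c) * (X - 1)| <= (F * X `^ (- p) + F * X `^ (- p)) * X.
  rewrite normrM; apply: ler_pM => //.
    by apply: le_trans (ler_normB _ _) _; exact: lerD.
  by rewrite ger0_norm ?gerBl// subr_ge0 ltW.
have total (A a b : R) : 2 * a * (A * b) + (A * b + A * b) * a = 4 * A * (a * b).
  by ring.
by move=> Hk; rewrite -total; exact: lerD.
Qed.

End contour_shift.

(** * Convolution with an integrable kernel *)

Section parametric_integral.
Context d1 d2 (T1 : measurableType d1) (T2 : measurableType d2) (R : realType).
Variable mu : {sigma_finite_measure set T2 -> \bar R}.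

(** Tonelli's theorem gives the measurability of the integrals of the positive
    and negative parts. *)
Lemma measurable_Rintegral_param (G : T1 * T2 -> R) :
  measurable_fun [set: T1 * T2] G ->
  measurable_fun [set: T1] (fun x => \int[mu]_y G (x, y)).
Proof.
move=> mG; have mE : measurable_fun [set: T1 * T2] (EFin \o G) by exact/measurable_EFinP.
have -> : (fun x => \int[mu]_y G (x, y)) =
    (fun x => fine ((\int[mu]_y ((EFin \o G)^\+)%E (x, y)) -
                    (\int[mu]_y ((EFin \o G)^\-)%E (x, y)))%E).
  apply/funext => x; rewrite /Rintegral integralE.
  by congr (fine (_ - _)); apply: eq_integral => y _; rewrite ?funeposE ?funenegE.
apply: (measurableT_comp (@fine_measurable R setT measurableT)).
apply: emeasurable_funB.
- apply: (@measurable_fun_fubini_tonelli_F _ _ _ _ _ mu) => //.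
  exact: measurable_funepos.
- apply: (@measurable_fun_fubini_tonelli_F _ _ _ _ _ mu) => //.
  exact: measurable_funeneg.
Qed.

End parametric_integral.

(** When the integral of g is not finite its real value is 0 by convention, and
    the bound covers this case too. *)
Lemma abs_Rintegral_le d (T : measurableType d) (R : realType)
    (mu : {measure set T -> \bar R}) (g h : T -> R) :
  measurable_fun [set: T] g -> measurable_fun [set: T] h ->
  (forall x, `|g x| <= h x) ->
  (`|\int[mu]_x g x|%:E <= \int[mu]_x (h x)%:E)%E.
Proof.
move=> mg mh gh; have mg' : measurable_fun [set: T] (EFin \o g) by exact/measurable_EFinP.
apply: (@le_trans _ _ `|\int[mu]_x (g x)%:E|%E).
  by rewrite /Rintegral; case: (\int[mu]_x (g x)%:E)%E => [r| |] //=; rewrite normr0 leey.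
apply: le_trans (le_abse_integral mu measurableT mg') _.
apply: ge0_le_integral => //=.
- by apply/measurable_EFinP; exact: measurableT_comp.
- exact/measurable_EFinP.
- by move=> x _; rewrite lee_fin.
Qed.

Section convolution.
Context (R : realType).
Implicit Types (f w : R -> R) (p c : R).

Lemma measurable_conv f w : measurable_fun [set: R] f -> measurable_fun [set: R] w ->
  measurable_fun [set: R] (fun x => \int[leb]_t (f t * w (x - t))).
Proof.
move=> mf mw.
apply: (@measurable_Rintegral_param _ _ _ _ R leb (fun z : R * R => f z.2 * w (z.1 - z.2))).
apply: measurable_funM; first by apply: (measurableT_comp mf).
by apply: (measurableT_comp mw); apply: measurable_funB.
Qed.

(** The kernel is dominated by an integrable function of x - t, and is used as
    the weight of the weighted Jensen inequality. *)
Lemma conv_Lp p c f w : 1 < p -> 0 <= c ->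
  measurable_fun [set: R] f -> measurable_fun [set: R] w ->
  (forall s, `|w s| <= c * decay 2 s) ->
  (\int[leb]_x (`|\int[leb]_t (f t * w (x - t))| `^ p)%:E <=
   ((2 * c) `^ p)%:E * \int[leb]_x (`|f x| `^ p)%:E)%E.
Proof.
move=> p1 c0 mf mw wc.
have p0 : 0 < p by lra.
have md : measurable_fun [set: R * R] (fun z : R * R => c * decay 2 (z.1 - z.2)).
  apply: measurable_funM => //.
  by apply: (measurableT_comp (@measurable_decay R 2)); apply: measurable_funB.
have mf2 : measurable_fun [set: R * R] (fun z : R * R => `|f z.2|).
  by apply: measurableT_comp => //; apply: (measurableT_comp mf).
have mdx x : measurable_fun [set: R] (fun t => decay 2 (x - t)).
  by apply: (measurableT_comp (@measurable_decay R 2)); apply: measurable_funB.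
have mdt t : measurable_fun [set: R] (fun x => decay 2 (x - t)).
  by apply: (measurableT_comp (@measurable_decay R 2)); apply: measurable_funB.
have two : (2 / (2 - 1) : R) = 2 by rewrite (_ : (2 - 1 : R) = 1) ?divr1//; ring.
have aA x : (\int[leb]_t (c * decay 2 (x - t))%:E <= (2 * c)%:E)%E.
  under eq_integral do rewrite EFinM.
  rewrite ge0_integralZl_EFin//.
  - rewrite integral_decayC; last by lra.
    by rewrite two -EFinM mulrC.
  - by move=> t _; rewrite lee_fin decay_ge0.
  - by apply/measurable_EFinP; exact: mdx.
have := @integral_power_kernel _ _ _ _ R leb leb _ _ p (2 * c) p1 md mf2
  (fun z => mulr_ge0 c0 (decay_ge0 2 (z.1 - z.2))) (fun z => normr_ge0 (f z.2)) aA.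
move=> H.
apply: (@le_trans _ _ (\int[leb]_x ((\int[leb]_t (c * decay 2 (x - t) * `|f t|)%:E) `^ p))%E).
  apply: ge0_le_integral => //.
  - apply/measurable_EFinP; apply: (measurableT_comp (@measurable_powR R p)).
    by apply: measurableT_comp => //; exact: measurable_conv.
  - apply: (measurableT_comp (measurable_poweR p)).
    apply: (@measurable_fun_fubini_tonelli_F _ _ _ _ _ leb
      (fun z : R * R => (c * decay 2 (z.1 - z.2) * `|f z.2|)%:E)).
      by apply/measurable_EFinP; exact: measurable_funM.
    by move=> z; rewrite lee_fin mulr_ge0// mulr_ge0// decay_ge0.
  - move=> x _; rewrite -poweR_EFin; apply: gt0_ler_poweR.
    + exact: ltW.
    + by rewrite in_itv/= lee_fin normr_ge0 leey.
    + rewrite in_itv/= leey andbT; apply: integral_ge0 => t _.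
      by rewrite lee_fin mulr_ge0// mulr_ge0// decay_ge0.
    + apply: abs_Rintegral_le => //.
      * by apply: measurable_funM => //; apply: (measurableT_comp mw); apply: measurable_funB.
      * by apply: measurable_funM => //; [apply: measurable_funM => //; exact: mdx|exact: measurableT_comp].
      * by move=> t; rewrite normrM mulrC ler_wpM2r.
apply: le_trans H _.
rewrite [in leLHS](_ : (\int[leb]_y _)%E = ((2 * c)%:E * \int[leb]_x (`|f x| `^ p)%:E)%E).
  rewrite muleA -EFinM lee_wpmul2r//.
    by apply: integral_ge0 => x _; rewrite lee_fin powR_ge0.
  by rewrite lee_fin mulrC mulr_powRB1// mulr_ge0.
have mfp : measurable_fun [set: R] (fun x => `|f x| `^ p).
  by apply: (measurableT_comp (@measurable_powR R p)); exact: measurableT_comp.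
rewrite -ge0_integralZl_EFin//; last 2 first.
- exact/measurable_EFinP.
- by rewrite mulr_ge0.
apply: eq_integral => t _ /=.
under eq_integral do rewrite EFinM.
rewrite ge0_integralZr//; last 2 first.
- by apply/measurable_EFinP; apply: measurable_funM => //; exact: mdt.
- by move=> x _; rewrite lee_fin mulr_ge0// decay_ge0.
congr (_ * _)%E; under eq_integral do rewrite EFinM.
rewrite ge0_integralZl_EFin//.
- rewrite integral_decay; last by lra.
  by rewrite two -EFinM mulrC.
- by move=> x _; rewrite lee_fin decay_ge0.
- by apply/measurable_EFinP; exact: mdt.
Qed.

End convolution.

(** * The conjugate Poisson integral on Lp, for p at most 2 *)

Section powers.
Context (R : realType).
Implicit Types (a b c p : R).

Lemma powR_le2 p a b c : 0 <= p -> `|a| <= `|b| + `|c| ->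
  `|a| `^ p <= 2 `^ p * (`|b| `^ p + `|c| `^ p).
Proof.
move=> p0 abc.
wlog bc : b c abc / `|b| <= `|c|.
  move=> H; have [/H|/ltW/H] := leP `|b| `|c|; first exact.
  by rewrite [X in _ * X]addrC; apply; rewrite addrC.
apply: (@le_trans _ _ ((2 * `|c|) `^ p)).
  by apply: ge0_ler_powR; rewrite ?nnegrE ?mulr_ge0//; lra.
rewrite powRM// ler_wpM2l ?powR_ge0// lerDr powR_ge0//.
Qed.

Lemma integral_powR_le2 p (F G H : R -> R) : 0 < p ->
  measurable_fun [set: R] F -> measurable_fun [set: R] G -> measurable_fun [set: R] H ->
  (forall x, `|F x| <= `|G x| + `|H x|) ->
  (\int[leb]_x (`|F x| `^ p)%:E <=
    (2 `^ p)%:E * (\int[leb]_x (`|G x| `^ p)%:E + \int[leb]_x (`|H x| `^ p)%:E))%E.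
Proof.
move=> p0 mF mG mH FGH.
have mp (K : R -> R) : measurable_fun [set: R] K -> measurable_fun [set: R] (fun x => (`|K x| `^ p)%:E).
  move=> mK; apply/measurable_EFinP; apply: (measurableT_comp (@measurable_powR R p)).
  exact: measurableT_comp.
rewrite -ge0_integralD//; try exact: mp; try by move=> x _; rewrite lee_fin powR_ge0.
rewrite -ge0_integralZl_EFin//; last 2 first.
- by move=> x _; rewrite -EFinD lee_fin addr_ge0 ?powR_ge0.
- by apply: emeasurable_funD; exact: mp.
apply: ge0_le_integral => //.
- exact: mp.
- by apply: emeasurable_funM => //; apply: emeasurable_funD; exact: mp.
- by move=> x _; rewrite -EFinD -EFinM lee_fin powR_le2// ltW.
Qed.

End powers.

Section riesz.
Context (R : realType).
Implicit Types (f : R -> R) (p : R).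

Lemma measurable_powRnorm p f : measurable_fun [set: R] f ->
  measurable_fun [set: R] (fun x => (`|f x| `^ p)%:E).
Proof.
move=> mf; apply/measurable_EFinP; apply: (measurableT_comp (@measurable_powR R p)).
exact: measurableT_comp.
Qed.

Lemma measurable_qker1 : measurable_fun [set: R] (qker ^~ (1 : R)).
Proof. by apply: continuous_measurable_fun; exact: continuous_qker. Qed.

Lemma measurable_pker1 : measurable_fun [set: R] (pker ^~ (1 : R)).
Proof. by apply: continuous_measurable_fun; exact: continuous_pker. Qed.

Lemma invD1sq_le_decay (s : R) : (s ^+ 2 + 1)^-1 <= 2 * decay 2 s.
Proof.
rewrite /decay powR_invn ?addr_ge0// -ler_pdivrMr ?invr_gt0 ?exprn_gt0 ?oneDnorm_gt0//.
rewrite invrK -lter_pdivlMl; last by rewrite invr_gt0 ltr_wpDl ?sqr_ge0.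
rewrite invrK; have := real_normK (num_real s); have := sqr_ge0 (1 - `|s|); lra.
Qed.

(** The pointwise inequality of Riesz is integrated over [-n, n]; the integral
    of the real part of G^p tends to 0 when n grows, and only the Poisson
    integral remains. *)
Lemma riesz_pext p f : 1 < p -> p <= 2 -> bcs f -> (forall x, 0 <= f x) ->
  0 < \int[leb]_x f x ->
  forall A B : R, 0 <= A -> 0 <= B ->
  (forall u v : R, 0 < u -> `|v| `^ p <= A * u `^ p -
    B * ((u ^+ 2 + v ^+ 2) `^ (p / 2) * cos (p * atan (v / u)))) ->
  (\int[leb]_x (`|qext f x 1| `^ p)%:E <= A%:E * \int[leb]_x (`|pext f x 1| `^ p)%:E)%E.
Proof.
move=> p1 p2 bf f0 m0 A B A0 B0 H.
have y1 : (2^-1 : R) < 1 by lra.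
have [mf _] := bf.
have mV : measurable_fun [set: R] (fun x => qext f x 1).
  exact: (measurable_conv mf measurable_qker1).
have mU : measurable_fun [set: R] (fun x => pext f x 1).
  exact: (measurable_conv mf measurable_pker1).
have cU : continuous (fun x => pext f x 1).
  by move=> x; exact: is_derive_continuous (is_derive_pext1 bf x y1).
have [E hE] := integral_repow_decay bf f0 m0 p1.
pose D n : set R := `[- n%:R, n%:R]%classic.
apply: (@fatou_le _ _ R leb (fun n => (fun x => (`|qext f x 1| `^ p)%:E) \_ (D n))).
- move=> n; apply/(measurable_restrictT _ _).1; first exact: measurable_itv.
  by apply: measurable_funTS; exact: measurable_powRnorm.
- by move=> n x; rewrite patchE; case: ifPn => // _; rewrite lee_fin powR_ge0.
- move=> x; apply: cvg_near_cst; near=> n.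
  rewrite patchE ifT// inE /D /= in_itv/= -ler_norml.
  by near: n; exact: nbhs_infty_ger.
move=> e e0.
have : \forall n \near \oo, (1 < n%:R :> R) /\ B * E * n%:R `^ (1 - p) <= e.
  have pm : 0 < p - 1 by lra.
  have /cvgrPdist_le := cvg_powRN_pinfty pm.
  have BE0 : 0 < e / (`|B * E| + 1) by rewrite divr_gt0// ltr_wpDl.
  move=> /(_ _ BE0)[M [_ hM]].
  near=> n; split; first by near: n; exact: nbhs_infty_gtr.
  have Mn : M < n%:R by near: n; exact: nbhs_infty_gtr.
  have := hM _ Mn; rewrite sub0r normrN opprB => h.
  apply: (@le_trans _ _ (`|B * E| * (e / (`|B * E| + 1)))).
    rewrite (le_trans (ler_norm _))// normrM ler_wpM2l//.
  by rewrite mulrCA ger_pMr// ler_pdivrMr ?ltr_wpDl// mul1r lerDl.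
apply: filterS => n [n1 nE]; rewrite -integral_mkcond.
pose h x := repow p (pext f x 1) (qext f x 1).
have up x : 0 < pext f x 1 by exact: pext_gt0.
have ch : continuous h.
  move=> x; exact: is_derive_continuous (@is_derive_repow R p (fun x => pext f x 1)
    (fun x => qext f x 1) x _ _ (up x) (is_derive_pext1 bf x y1) (is_derive_qext1 bf x y1)).
have cUp : continuous (fun x => `|pext f x 1| `^ p).
  have -> : (fun x => `|pext f x 1| `^ p) = (fun x => pext f x 1 `^ p).
    by apply/funext => x; rewrite gtr0_norm.
  move=> x; apply: (@continuous_comp _ _ _ (fun x => pext f x 1) (fun z => z `^ p)).
    exact: cU.
  exact: is_derive_continuous (is_derive1_powR p (up x)).
have ci (g : R -> R) : continuous g -> leb.-integrable (D n) (EFin \o g).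
  move=> cg; apply: continuous_compact_integrable; first exact: segment_compact.
  exact: continuous_subspaceT.
have mD : measurable (D n) by exact: measurable_itv.
have iU := ci _ cUp; have ih := ci _ ch.
have iAU : leb.-integrable (D n) (EFin \o (fun x => A * `|pext f x 1| `^ p)).
  by apply: ci => x; apply: cvgM; [exact: cvg_cst|exact: cUp].
have iBh : leb.-integrable (D n) (EFin \o (fun x => B * h x)).
  by apply: ci => x; apply: cvgM; [exact: cvg_cst|exact: ch].
have cg : continuous (fun x => A * `|pext f x 1| `^ p - B * h x).
  move=> x; apply: cvgB; apply: cvgM; first exact: cvg_cst.
  - exact: cUp.
  - exact: cvg_cst.
  - exact: ch.
apply: (@le_trans _ _ (\int[leb]_(x in D n) (A * `|pext f x 1| `^ p - B * h x)%:E)%E).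
  apply: ge0_le_integral => //.
  - by apply: measurable_funTS; exact: measurable_powRnorm.
  - by have /integrableP[] := ci _ cg.
  - move=> x _; rewrite lee_fin (gtr0_norm (up x)).
    exact: H.
rewrite integralB_EFin//.
apply: leeD.
  under eq_integral do rewrite EFinM.
  rewrite ge0_integralZl_EFin//; last first.
    by apply: measurable_funTS; exact: measurable_powRnorm.
  apply: lee_wpmul2l; first by rewrite lee_fin.
  apply: ge0_subset_integral => //; exact: measurable_powRnorm.
have -> : (\int[leb]_(x in D n) (B * h x)%:E = (B * \int[leb]_(x in D n) h x)%:E)%E.
  rewrite -RintegralZl// /Rintegral fineK//.
  exact: integrable_fin_num.
rewrite -EFinN lee_fin; apply: le_trans nE.
have := hE _ n1; rewrite ler_norml => /andP[hE1 _].
rewrite -mulrN -mulrA ler_wpM2l//.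
by rewrite lerNl.
Unshelve. all: by end_near. Qed.

(** A nonnegative f with zero integral has vanishing Poisson integrals;
    otherwise the previous lemma compares the conjugate Poisson integral with
    the Poisson integral, which is a convolution with an integrable kernel. *)
Lemma riesz_ge0 p : 1 < p -> p <= 2 -> exists2 C : R, 0 <= C &
  forall f, bcs f -> (forall x, 0 <= f x) ->
  (\int[leb]_x (`|\int[leb]_t (f t * qker (x - t) 1)| `^ p)%:E <=
   C%:E * \int[leb]_x (`|f x| `^ p)%:E)%E.
Proof.
move=> p1 p2; have [A [B [A0 B0 H]]] := riesz_pointwise p1 p2.
have p0 : p != 0 by rewrite gt_eqF//; lra.
exists (A * (2 * 2) `^ p); first by rewrite mulr_ge0 ?powR_ge0.
move=> f bf f0; have [mf _] := bf.
have J0 : (0 <= \int[leb]_x (`|f x| `^ p)%:E)%E.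
  by apply: integral_ge0 => x _; rewrite lee_fin powR_ge0.
have m0 : 0 <= \int[leb]_x f x by exact: Rintegral_ge0.
move: m0; rewrite le_eqVlt => /predU1P[m0|m0].
  under eq_integral => x _.
    have vx0 : \int[leb]_t (f t * qker (x - t) 1) = 0.
      apply/eqP; rewrite -normr_le0.
      have -> : 0 = 4 * \int[leb]_x `|f x|.
        rewrite (_ : \int[leb]_x `|f x| = 0) ?mulr0// m0.
        by apply: eq_Rintegral => y _; rewrite ger0_norm.
      apply: le_normr_bcs => //; last by move=> t; apply: qker_le; lra.
      by apply: (measurable_subx (K := qker ^~ 1)); exact: continuous_qker.
    rewrite vx0 normr0 powR0//.
    over.
  rewrite integral0 mule_ge0// lee_fin mulr_ge0// powR_ge0.
apply: le_trans (riesz_pext p1 p2 bf f0 m0 A0 B0 H) _.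
rewrite EFinM -muleA; apply: lee_wpmul2l; first by rewrite lee_fin.
apply: (conv_Lp (w := pker ^~ 1) p1 _ mf measurable_pker1) => // s.
 rewrite /pker expr1n mul1r ger0_norm; first exact: invD1sq_le_decay.
by rewrite invr_ge0 addr_ge0// sqr_ge0.
Qed.

Lemma bcs_le f (g : R -> R) : bcs f -> measurable_fun [set: R] g -> (forall x, `|g x| <= `|f x|) ->
  bcs g.
Proof.
move=> [mf [M [N fM]]] mg gf; split => //; exists M, N => x.
exact: le_trans (gf x) (fM x).
Qed.

Lemma riesz_signed p : 1 < p -> p <= 2 -> exists2 C : R, 0 <= C &
  forall f, bcs f ->
  (\int[leb]_x (`|\int[leb]_t (f t * qker (x - t) 1)| `^ p)%:E <=
   C%:E * \int[leb]_x (`|f x| `^ p)%:E)%E.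
Proof.
move=> p1 p2; have [C C0 HC] := riesz_ge0 p1 p2.
have p0 : 0 < p by lra.
exists (2 `^ p * (C + C)); first by rewrite mulr_ge0 ?powR_ge0// addr_ge0.
move=> f bf; have [mf _] := bf.
have mf1 : measurable_fun [set: R] f^\+ by exact: measurable_funrpos.
have mf2 : measurable_fun [set: R] f^\- by exact: measurable_funrneg.
have f1 x : `|f^\+ x| <= `|f x|.
  by rewrite ger0_norm ?funrpos_ge0// /funrpos; case: (leP (f x) 0) => // *; rewrite ler_norm.
have f2 x : `|f^\- x| <= `|f x|.
  rewrite ger0_norm ?funrneg_ge0// /funrneg; case: (leP (- f x) 0) => // *.
  by rewrite -normrN ler_norm.
have b1 := bcs_le bf mf1 f1; have b2 := bcs_le bf mf2 f2.
have bq x : exists C, forall t : R, `|qker (x - t) 1| <= C.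
  by exists 4 => t; apply: qker_le; lra.
have mq x : measurable_fun [set: R] (fun t => qker (x - t) 1).
  by apply: (measurable_subx (K := qker ^~ 1)); exact: continuous_qker.
apply: le_trans (integral_powR_le2 p0 (G := fun x => \int[leb]_t (f^\+ t * qker (x - t) 1))
  (H := fun x => \int[leb]_t (f^\- t * qker (x - t) 1)) _ _ _ _) _.
- exact: (measurable_conv mf measurable_qker1).
- exact: (measurable_conv mf1 measurable_qker1).
- exact: (measurable_conv mf2 measurable_qker1).
- move=> x.
  have -> : \int[leb]_t (f t * qker (x - t) 1) =
     \int[leb]_t (f^\+ t * qker (x - t) 1) - \int[leb]_t (f^\- t * qker (x - t) 1).
    rewrite -RintegralB//; try by apply: bcs_integrableM.
    apply: eq_Rintegral => t _; rewrite -mulrBl; congr (_ * _).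
    by rewrite -[in LHS](funrposBneg f).
  exact: ler_normB.
rewrite EFinM -muleA; apply: lee_wpmul2l; first by rewrite lee_fin powR_ge0.
have I0 (g : R -> R) : (0 <= \int[leb]_x (`|g x| `^ p)%:E)%E.
  by apply: integral_ge0 => x _; rewrite lee_fin powR_ge0.
rewrite EFinD ge0_muleDl ?lee_fin//.
have le12 (g : R -> R) : measurable_fun [set: R] g -> (forall x, `|g x| <= `|f x|) ->
   (\int[leb]_x (`|g x| `^ p)%:E <= \int[leb]_x (`|f x| `^ p)%:E)%E.
  move=> mg gf; apply: ge0_le_integral => //; try exact: measurable_powRnorm.
  by move=> x _; rewrite lee_fin; apply: ge0_ler_powR; rewrite ?nnegrE// ltW.
apply: leeD.
  apply: le_trans (HC _ b1 (funrpos_ge0 _)) _.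
  by apply: lee_wpmul2l; [rewrite lee_fin|exact: le12].
apply: le_trans (HC _ b2 (funrneg_ge0 _)) _.
by apply: lee_wpmul2l; [rewrite lee_fin|exact: le12].
Qed.

End riesz.

(** * The segment multiplier on Lp, for p at most 2 *)

Section sinc.
Context {R : realType}.
Implicit Types (f g : R -> R) (p s x : R).

(** The kernel of the segment multiplier, with value 0 at 0 as in the definition
    of the operator. *)
Definition sinck s : R := sin s / s.

Lemma norm_sin_le s : `|sin s| <= `|s|.
Proof.
wlog s0 : s / 0 <= s => [H|].
  have [/H//|sN] := leP 0 s.
  by rewrite -[`|s|]normrN -[`|sin s|]normrN -sinN; apply: H; lra.
move: s0; rewrite le_eqVlt => /predU1P[<-|s0]; first by rewrite sin0.
have [c _ H] : exists2 c, c \in `]0, s[ & sin s - sin 0 = cos c * (s - 0).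
  apply: (@MVT _ sin cos) => //.
  by apply: continuous_subspaceT; exact: continuous_sin.
move: H; rewrite sin0 !subr0 => ->.
by rewrite normrM ler_piMl// cos_max.
Qed.

Lemma sinckN s : sinck (- s) = sinck s.
Proof. by rewrite /sinck sinN invrN mulrNN. Qed.

Lemma sinck_le1 s : `|sinck s| <= 1.
Proof.
rewrite /sinck normrM normfV; have [->|s0] := eqVneq s 0.
  by rewrite normr0 invr0 mulr0.
by rewrite ler_pdivrMr ?normr_gt0// mul1r norm_sin_le.
Qed.

Lemma sinck_decay s : `|sinck s| <= 2 * decay 1 s.
Proof.
have s1 := oneDnorm_gt0 s.
rewrite /decay powR_inv1 ?(ltW s1)// ler_pdivlMr// mulrDr mulr1.
have -> : 2 = 1 + 1 :> R by [].
apply: lerD; first exact: sinck_le1.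
rewrite /sinck normrM normfV; have [->|s0] := eqVneq s 0.
  by rewrite normr0 mulr0.
by rewrite mulfVK ?normr_eq0// sin_max.
Qed.

Lemma measurable_sin : measurable_fun [set: R] (@sin R).
Proof. by apply: continuous_measurable_fun; exact: continuous_sin. Qed.

Lemma measurable_cos : measurable_fun [set: R] (@cos R).
Proof. by apply: continuous_measurable_fun; exact: continuous_cos. Qed.

Lemma measurable_sinck : measurable_fun [set: R] sinck.
Proof. by apply: measurable_funM; [exact: measurable_sin|exact: measurable_invr]. Qed.

Lemma measurable_sinckB x : measurable_fun [set: R] (fun t => sinck (x - t)).
Proof. by apply: (measurableT_comp measurable_sinck); apply: measurable_funB. Qed.

Definition Sop f x := \int[leb]_t (f t * sinck (x - t)).

Lemma measurable_Sop f : measurable_fun [set: R] f -> measurable_fun [set: R] (Sop f).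
Proof. by move=> mf; exact: (measurable_conv mf measurable_sinck). Qed.

(** The part of the kernel that is left once sin t / t is replaced by sin t
    times the conjugate Poisson kernel at height one. It is integrable. *)
Definition sinc_error s : R := sinck s - sin s * qker s 1.

Lemma sinc_errorE s : sinc_error s = sinck s / (s ^+ 2 + 1).
Proof.
rewrite /sinc_error /sinck /qker expr1n; have [->|s0] := eqVneq s 0.
  by rewrite sin0 !mul0r subrr.
have : s ^+ 2 + 1 != 0 by rewrite gt_eqF// ltr_wpDl ?sqr_ge0.
by move=> h; field; rewrite h s0.
Qed.

Lemma sinc_error_le s : `|sinc_error s| <= 2 * decay 2 s.
Proof.
have s1 : 0 < s ^+ 2 + 1 by rewrite ltr_wpDl ?sqr_ge0.
apply: le_trans (invD1sq_le_decay s).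
rewrite sinc_errorE normrM normfV (gtr0_norm s1).
by rewrite ler_piMl ?sinck_le1// invr_ge0 ltW.
Qed.

Lemma measurable_sinc_error : measurable_fun [set: R] sinc_error.
Proof.
apply: measurable_funB; first exact: measurable_sinck.
by apply: measurable_funM; [exact: measurable_sin|exact: measurable_qker1].
Qed.

Lemma bcs_sinck f x : bcs f -> leb.-integrable [set: R] (EFin \o (fun t => f t * sinck (x - t))).
Proof.
move=> bf; apply: bcs_integrableM => //; first exact: measurable_sinckB.
by exists 1 => t; exact: sinck_le1.
Qed.

(** From sin (x - t) = sin x cos t - cos x sin t, the multiplier is a
    combination of two modulated conjugate Poisson integrals, up to an
    integrable kernel. *)
Lemma Sop_decomp f x : bcs f ->
  Sop f x = (sin x * (\int[leb]_t (f t * cos t * qker (x - t) 1)) -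
             cos x * (\int[leb]_t (f t * sin t * qker (x - t) 1))) +
            \int[leb]_t (f t * sinc_error (x - t)).
Proof.
move=> bf.
have b1 : bcs (fun t => f t * cos t).
  by apply: bcsM => //; [exact: measurable_cos|exists 1 => t; exact: cos_max].
have b2 : bcs (fun t => f t * sin t).
  by apply: bcsM => //; [exact: measurable_sin|exists 1 => t; exact: sin_max].
have bq : exists C, forall t : R, `|qker (x - t) 1| <= C.
  by exists 4 => t; apply: qker_le; lra.
have mq : measurable_fun [set: R] (fun t => qker (x - t) 1).
  by apply: (measurable_subx (K := qker ^~ 1)); exact: continuous_qker.
have i1 := bcs_integrableM b1 mq bq; have i2 := bcs_integrableM b2 mq bq.
have me : measurable_fun [set: R] (fun t => sinc_error (x - t)).
  by apply: (measurableT_comp measurable_sinc_error); apply: measurable_funB.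
have ie : leb.-integrable [set: R] (EFin \o (fun t => f t * sinc_error (x - t))).
  apply: bcs_integrableM => //; exists 2 => t.
  apply: le_trans (sinc_error_le _) _; rewrite ler_piMr//.
  rewrite /decay powR_invn ?addr_ge0// invf_le1 ?exprn_gt0 ?oneDnorm_gt0//.
  by rewrite exprn_ege1// lerDl.
rewrite -!RintegralZl// -RintegralB//; last 2 first.
- by apply: (integrableZl measurableT (sin x) i1).
- by apply: (integrableZl measurableT (cos x) i2).
rewrite -RintegralD//; last first.
- apply: (integrableB measurableT (integrableZl measurableT (sin x) i1)
    (integrableZl measurableT (cos x) i2)).
by apply: eq_Rintegral => t _; rewrite /sinc_error sinB; ring.
Qed.

Lemma riesz_Sop_le2 p : 1 < p -> p <= 2 -> exists2 C : R, 0 <= C & forall f, bcs f ->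
  (\int[leb]_x (`|Sop f x| `^ p)%:E <= C%:E * \int[leb]_x (`|f x| `^ p)%:E)%E.
Proof.
move=> p1 p2; have [C C0 HC] := riesz_signed p1 p2.
have p0 : 0 < p by lra.
exists (2 `^ p * (2 `^ p * (C + C) + (2 * 2) `^ p)).
  by rewrite mulr_ge0 ?powR_ge0// addr_ge0 ?powR_ge0// mulr_ge0 ?powR_ge0// addr_ge0.
move=> f bf; have [mf _] := bf.
pose f1 (t : R) := f t * cos t; pose f2 (t : R) := f t * sin t.
have b1 : bcs f1 by apply: bcsM => //; [exact: measurable_cos|exists 1 => t; exact: cos_max].
have b2 : bcs f2 by apply: bcsM => //; [exact: measurable_sin|exists 1 => t; exact: sin_max].
have [mf1 _] := b1; have [mf2 _] := b2.
pose Q (g : R -> R) (x : R) := \int[leb]_t (g t * qker (x - t) 1).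
pose E (x : R) := \int[leb]_t (f t * sinc_error (x - t)).
have mQ1 : measurable_fun [set: R] (Q f1).
  have H := (measurable_conv mf1 (@measurable_qker1 R)). exact H.
have mQ2 : measurable_fun [set: R] (Q f2) by exact: (measurable_conv mf2 (@measurable_qker1 R)).
have mE : measurable_fun [set: R] E by exact: (measurable_conv mf measurable_sinc_error).
have mW : measurable_fun [set: R] (fun x => sin x * Q f1 x - cos x * Q f2 x).
  apply: measurable_funB; apply: measurable_funM => //;
    by [exact: measurable_sin|exact: measurable_cos].
have le12 (g : R -> R) : measurable_fun [set: R] g -> (forall x, `|g x| <= `|f x|) ->
   (\int[leb]_x (`|g x| `^ p)%:E <= \int[leb]_x (`|f x| `^ p)%:E)%E.
  move=> mg gf; apply: ge0_le_integral => //; try exact: measurable_powRnorm.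
  by move=> x _; rewrite lee_fin; apply: ge0_ler_powR; rewrite ?nnegrE// ltW.
have H1 : (\int[leb]_x (`|Q f1 x| `^ p)%:E <= C%:E * \int[leb]_x (`|f x| `^ p)%:E)%E.
  apply: le_trans (HC _ b1) _; apply: lee_wpmul2l; first by rewrite lee_fin.
  by apply: le12 => // x; rewrite /f1 normrM ler_piMr// cos_max.
have H2 : (\int[leb]_x (`|Q f2 x| `^ p)%:E <= C%:E * \int[leb]_x (`|f x| `^ p)%:E)%E.
  apply: le_trans (HC _ b2) _; apply: lee_wpmul2l; first by rewrite lee_fin.
  by apply: le12 => // x; rewrite /f2 normrM ler_piMr// sin_max.
have H3 : (\int[leb]_x (`|E x| `^ p)%:E <= ((2 * 2) `^ p)%:E * \int[leb]_x (`|f x| `^ p)%:E)%E.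
  exact: (conv_Lp p1 _ mf measurable_sinc_error sinc_error_le).
have I0 (g : R -> R) : (0 <= \int[leb]_x (`|g x| `^ p)%:E)%E.
  by apply: integral_ge0 => x _; rewrite lee_fin powR_ge0.
have t0 : (0 <= (2 `^ p)%:E :> \bar R)%E by rewrite lee_fin powR_ge0.
apply: le_trans (integral_powR_le2 p0 (measurable_Sop mf) mW mE _) _.
  by move=> x; rewrite Sop_decomp//; exact: ler_normD.
rewrite EFinM -muleA; apply: lee_wpmul2l; first exact: t0.
rewrite EFinD ge0_muleDl ?lee_fin ?mulr_ge0 ?powR_ge0 ?addr_ge0//.
apply: leeD => //.
apply: le_trans (integral_powR_le2 p0 mW mQ1 mQ2 _) _.
  move=> x; apply: le_trans (ler_normB _ _) _.
  by apply: lerD; rewrite normrM ler_piMl// ?sin_max ?cos_max.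
rewrite EFinM -muleA; apply: lee_wpmul2l; first exact: t0.
rewrite EFinD ge0_muleDl ?lee_fin//.
apply: leeD; [exact: H1|exact: H2].
Qed.

End sinc.

(** * Duality: the segment multiplier on Lp, for p above 2 *)

Section duality.
Context {R : realType}.
Implicit Types (f g : R -> R) (p s x : R).

Lemma norm_Sop_le f x : bcs f -> `|Sop f x| <= \int[leb]_t `|f t|.
Proof.
move=> bf; rewrite -[leRHS]mul1r; apply: le_normr_bcs => //.
  exact: measurable_sinckB.
by move=> t; exact: sinck_le1.
Qed.

Lemma bcs_norm_fin f : bcs f -> (\int[leb]_x `|(f x)%:E| < +oo)%E.
Proof. by move=> /bcs_integrable/integrableP[]. Qed.

(** The kernel is even, so that the operator is symmetric; for bounded functions
    with compact support Fubini's theorem applies. *)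
Lemma integral_mul_Sop f g : bcs f -> bcs g ->
  \int[leb]_x (g x * Sop f x) = \int[leb]_x (f x * Sop g x).
Proof.
move=> bf bg; have [mf _] := bf; have [mg _] := bg.
pose G (z : R * R) := g z.1 * f z.2 * sinck (z.1 - z.2).
have mG : measurable_fun [set: R * R] G.
  apply: measurable_funM; first apply: measurable_funM.
  - by apply: (measurableT_comp mg).
  - by apply: (measurableT_comp mf).
  - by apply: (measurableT_comp measurable_sinck); apply: measurable_funB.
have mGE : measurable_fun [set: R * R] (EFin \o G) by exact/measurable_EFinP.
have iG : (leb \x leb)%E.-integrable [set: R * R] (EFin \o G).
  apply/(integrable12ltyP leb leb mGE).
  apply: (@le_lt_trans _ _ (\int[leb]_x (`|(g x)%:E| * \int[leb]_t `|(f t)%:E|))%E).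
    apply: ge0_le_integral => //.
    - by move=> x _; apply: integral_ge0.
    - apply: (@measurable_fun_fubini_tonelli_F _ _ _ _ _ leb (fun z => `|(EFin \o G) z|%E)) => //.
      exact: measurableT_comp.
    - apply: emeasurable_funM => //.
      by apply: measurableT_comp => //; exact/measurable_EFinP.
    - move=> x _; rewrite -ge0_integralZl//; last first.
        by apply: measurableT_comp => //; exact/measurable_EFinP.
      apply: ge0_le_integral => //.
      + apply: measurableT_comp => //; apply/measurable_EFinP.
        apply: (measurable_funM _ (measurable_sinckB x)).
        by apply: (measurable_funM (measurable_cst (g x)) mf).
      + apply: emeasurable_funM => //.
        by apply: measurableT_comp => //; exact/measurable_EFinP.
      + move=> t _; rewrite /G/= -EFinM lee_fin normrM [X in X * _ <= _]normrM.
        by rewrite ler_piMr ?sinck_le1// mulr_ge0.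
  rewrite ge0_integralZr//; last 2 first.
  - by apply: measurableT_comp => //; exact/measurable_EFinP.
  - exact: integral_ge0.
  apply: lte_mul_pinfty; [exact: integral_ge0| |exact: bcs_norm_fin].
  by rewrite ge0_fin_numE ?bcs_norm_fin//; exact: integral_ge0.
have F := congr1 fine (Fubini iG).
transitivity (fine (\int[leb]_x \int[leb]_y (EFin \o G) (x, y))%E).
  congr fine; apply: eq_integral => x _.
  rewrite /Sop -RintegralZl//; last exact: bcs_sinck.
  have iq := integrableZl measurableT (g x) (bcs_sinck x bf).
  rewrite /Rintegral fineK; last by apply: (integrable_fin_num (mu := leb) measurableT iq).
  by apply: eq_integral => t _; rewrite /G/= mulrA.
rewrite F; congr fine; apply: eq_integral => x _.
rewrite /Sop -RintegralZl//; last exact: bcs_sinck.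
have iq := integrableZl measurableT (f x) (bcs_sinck x bg).
rewrite /Rintegral fineK; last by apply: (integrable_fin_num (mu := leb) measurableT iq).
apply: eq_integral => t _; rewrite /G/= -(sinckN (x - t)) opprB.
by congr EFin; ring.
Qed.

(** Let q <= 2 be the conjugate exponent. On [-n, n], the integral J of |Sf|^p
    is the pairing of Sf with g = Sf |Sf|^(p-2), hence of f with Sg. Young's
    inequality for products splits it into multiples of the integral of |f|^p
    and of that of |Sg|^q <= C |g|^q, and |g|^q = |Sf|^p. For a suitable scaling
    the second part is at most J / 2, and it is absorbed since J is finite. *)
Lemma riesz_Sop_gt2 p : 2 < p -> exists2 C : R, 0 <= C & forall f, bcs f ->
  (\int[leb]_x (`|Sop f x| `^ p)%:E <= C%:E * \int[leb]_x (`|f x| `^ p)%:E)%E.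
Proof.
move=> p2; pose q := p / (p - 1).
have p0 : 0 < p by lra.
have q1 : 1 < q by rewrite /q ltr_pdivlMr; lra.
have q2 : q <= 2 by rewrite /q ler_pdivrMr; lra.
have q0 : 0 < q by lra.
have pq : p^-1 + q^-1 = 1 by rewrite /q; field; rewrite !gt_eqF//; lra.
have [C C0 HC] := riesz_Sop_le2 q1 q2.
(* dividing by l makes the constant of S on Lq at most 1 / 2 *)
pose l := (2 * C + 1) `^ q^-1.
have l0 : 0 < l by apply: powR_gt0; lra.
have lq : l `^ q = 2 * C + 1 by rewrite /l -powRrM mulVf ?gt_eqF// powRr1//; lra.
exists (2 * l `^ p); first by rewrite mulr_ge0 ?powR_ge0.
move=> f bf; have [mf _] := bf.
pose phi := Sop f; pose B := \int[leb]_t `|f t|.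
have mphi : measurable_fun [set: R] phi by exact: measurable_Sop.
have phiB x : `|phi x| <= B by exact: norm_Sop_le.
have F0 : (0 <= \int[leb]_x (`|f x| `^ p)%:E)%E.
  by apply: integral_ge0 => x _; rewrite lee_fin powR_ge0.
pose D n : set R := `[- n%:R, n%:R]%classic.
pose psi n x := `|phi x| `^ p * \1_(D n) x.
have mD n : measurable (D n) by exact: measurable_itv.
have m1 n : measurable_fun [set: R] (\1_(D n) : R -> R) by exact: measurable_indic.
have m1' n : measurable_fun [set: R] (psi n).
  apply: measurable_funM => //; apply: (measurableT_comp (@measurable_powR R p)).
  exact: measurableT_comp.
have psi0 n x : 0 <= psi n x by rewrite mulr_ge0 ?powR_ge0// indicE.
apply: (@fatou_le _ _ R leb (fun n x => (psi n x)%:E)).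
- by move=> n; apply/measurable_EFinP; exact: m1'.
- by move=> n x; rewrite lee_fin.
- move=> x; apply: cvg_near_cst; near=> n.
  rewrite /psi indicE (_ : x \in D n) ?mulr1//.
  by rewrite inE /D/= in_itv/= -ler_norml; near: n; exact: nbhs_infty_ger.
move=> e e0; near=> n.
apply: le_trans (leeDl _ _); last by rewrite lee_fin ltW.
have B0 : 0 <= B by apply: le_trans (phiB 0).
have Dn x : \1_(D n) x = (`|x| <= n%:R)%R%:R :> R.
  rewrite indicE (_ : (x \in D n) = (`|x| <= n%:R))//.
  by rewrite ler_norml; apply/idP/idP; rewrite inE /D/= in_itv.
(* the function that realizes the duality; the exponent p - 2 is positive *)
pose g x := phi x * `|phi x| `^ (p - 1 - 1) * \1_(D n) x.
have p1 : 0 < p - 1 by lra.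
have phg x : g x * phi x = psi n x.
  rewrite /g /psi mulrAC; congr (_ * _).
  rewrite mulrAC -expr2 -(real_normK (num_real (phi x))) expr2 -mulrA.
  by rewrite mulr_powRB1// mulr_powRB1.
have ng x : `|g x| = `|phi x| `^ (p - 1) * \1_(D n) x.
  rewrite /g !normrM (ger0_norm (powR_ge0 _ _)) mulr_powRB1//.
  by rewrite Dn normr_nat.
have bg : bcs g.
  split.
    apply: (measurable_funM _ (m1 n)); apply: measurable_funM => //.
    apply: (measurableT_comp (@measurable_powR R _)); exact: measurableT_comp.
  exists (B `^ (p - 1)), n%:R => x; rewrite ng Dn ler_wpM2r//.
  by apply: ge0_ler_powR; rewrite ?nnegrE//; exact: ltW.
have [mg _] := bg.
have gq x : `|g x| `^ q = psi n x.
  rewrite ng /psi powRM ?powR_ge0 ?Dn// -powRrM; congr (_ `^ _ * _).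
    by rewrite /q; field; rewrite gt_eqF.
  by case: (_ <= _); rewrite ?powR1// powR0// gt_eqF.
have bpsi : bcs (psi n).
  split; first exact: m1'.
  exists (B `^ p), n%:R => x; rewrite ger0_norm// /psi Dn ler_wpM2r//.
  by apply: ge0_ler_powR; rewrite ?nnegrE//; exact: ltW.
have Jfin : (\int[leb]_x (psi n x)%:E)%E \is a fin_num.
  by apply: (integrable_fin_num (mu := leb) measurableT (bcs_integrable bpsi)).
have mSg := measurable_Sop mg.
set J := (\int[leb]_x (psi n x)%:E)%E in Jfin *.
have m2 : measurable_fun [set: R] (fun x => (l * `|f x|) `^ p).
  apply: (measurableT_comp (@measurable_powR R p)); apply: measurable_funM => //.
  exact: measurableT_comp.
have m3 : measurable_fun [set: R] (fun x => (`|Sop g x| / l) `^ q).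
  apply: (measurableT_comp (@measurable_powR R q)); apply: measurable_funM => //.
  exact: measurableT_comp.
have H1 : (J <= \int[leb]_x ((l * `|f x|) `^ p)%:E + \int[leb]_x ((`|Sop g x| / l) `^ q)%:E)%E.
  have -> : J = (\int[leb]_x (f x * Sop g x))%:E.
    rewrite -integral_mul_Sop// /Rintegral.
    by rewrite -[LHS]fineK//; congr (fine _)%:E; apply: eq_integral => x _; rewrite -phg.
  rewrite -ge0_integralD//; try (by move=> x _; rewrite lee_fin powR_ge0);
    try exact/measurable_EFinP.
  apply: (@le_trans _ _ (`|\int[leb]_x (f x * Sop g x)|)%:E).
    by rewrite lee_fin ler_norm.
  apply: (@abs_Rintegral_le _ _ R leb (fun x => f x * Sop g x)
    (fun x => (l * `|f x|) `^ p + (`|Sop g x| / l) `^ q)).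
  - exact: measurable_funM.
  - exact: measurable_funD.
  - move=> x; rewrite normrM.
    have -> : `|f x| * `|Sop g x| = (l * `|f x|) * (`|Sop g x| / l).
      by field; rewrite gt_eqF.
    apply: le_trans (@conjugate_powR _ _ _ p q _ _ _ _ _) _ => //.
    + by rewrite mulr_ge0// ltW.
    + by rewrite divr_ge0// ltW.
    + by apply: lerD; rewrite ler_piMr ?powR_ge0// invf_le1//; lra.
have H2 : (\int[leb]_x ((`|Sop g x| / l) `^ q)%:E <= (2^-1)%:E * J)%E.
  have E x : ((`|Sop g x| / l) `^ q)%:E = ((2 * C + 1)^-1%:E * (`|Sop g x| `^ q)%:E)%E.
    rewrite powRM ?invr_ge0 ?(ltW l0)// -EFinM mulrC; congr (_ * _)%:E.
    by rewrite -lq -powR_inv1 ?(ltW l0)// -powRrM mulN1r powRN.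
  under eq_integral do rewrite E.
  rewrite ge0_integralZl_EFin//; last 2 first.
  - exact: measurable_powRnorm.
  - by rewrite invr_ge0; lra.
  have E2 : J = (\int[leb]_x (`|g x| `^ q)%:E)%E by apply: eq_integral => x _; rewrite gq.
  apply: (@le_trans _ _ ((2 * C + 1)^-1%:E * (C%:E * J))%E).
    apply: lee_wpmul2l; first by rewrite lee_fin invr_ge0; lra.
    by rewrite E2; exact: HC.
  rewrite muleA -EFinM; apply: lee_wpmul2r; first by apply: integral_ge0 => x _; rewrite lee_fin.
  by rewrite lee_fin mulrC ler_pdivrMr; lra.
have H3 : (\int[leb]_x ((l * `|f x|) `^ p)%:E = (l `^ p)%:E * \int[leb]_x (`|f x| `^ p)%:E)%E.
  under eq_integral do rewrite powRM ?(ltW l0)// EFinM.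
  rewrite ge0_integralZl_EFin//; first exact: measurable_powRnorm.
  exact: powR_ge0.
rewrite H3 in H1.
rewrite EFinM -muleA.
have X0 : (0 <= (l `^ p)%:E * \int[leb]_x (`|f x| `^ p)%:E)%E.
  by rewrite mule_ge0// lee_fin powR_ge0.
set X := ((l `^ p)%:E * _)%E in H1 X0 *.
have := le_trans H1 (leeD (lexx X) H2).
case: X X0 {H1} => [X| |] X0 //=; last first.
  by rewrite mulry gtr0_sg// mul1e leey.
rewrite -(fineK Jfin) -!EFinM -EFinD !lee_fin; lra.
Unshelve. all: by end_near. Qed.

End duality.

(** * The segment multiplier on all of Lp and on L1 *)

Section extension.
Context {R : realType}.
Implicit Types (f g : R -> R) (p r s t x : R).

Lemma riesz_Sop_bcs p : 1 < p -> exists2 C : R, 0 <= C & forall f, bcs f ->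
  (\int[leb]_x (`|Sop f x| `^ p)%:E <= C%:E * \int[leb]_x (`|f x| `^ p)%:E)%E.
Proof.
by move=> p1; have [p2|p2] := leP p 2; [exact: riesz_Sop_le2|exact: riesz_Sop_gt2].
Qed.

(** At a nonzero limit the power is differentiable, hence continuous; at 0 the
    convergence is checked by hand. *)
Lemma cvg_normr_powR p (w : R^nat) (l : R) : 0 < p -> w n @[n --> \oo] --> l ->
  (`|w n| `^ p) @[n --> \oo] --> `|l| `^ p.
Proof.
move=> p0 wl; have nwl : `|w n| @[n --> \oo] --> `|l| by exact: cvg_norm.
have [l0|l0] := eqVneq l 0; last first.
  have lp : 0 < `|l| by rewrite normr_gt0.
  exact: (cvg_comp _ _ nwl (is_derive_continuous (is_derive1_powR p lp))).
rewrite l0 normr0 powR0 ?gt_eqF// in nwl *.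
apply/cvgrPdist_le => e e0.
have e1 : 0 < e `^ p^-1 by exact: powR_gt0.
move/cvgrPdist_le : nwl => /(_ _ e1); apply: filterS => n.
rewrite !sub0r !normrN normr_id => we.
rewrite ger0_norm ?powR_ge0//.
have -> : e = (e `^ p^-1) `^ p by rewrite -powRrM mulVf ?gt_eqF// powRr1// ltW.
by apply: ge0_ler_powR; rewrite ?nnegrE ?powR_ge0// ltW.
Qed.

Section fixed_exponent.
Variable p : R.
Hypothesis p1 : 1 < p.
Let q : R := p / (p - 1).
Let p0 : 0 < p. Proof. by rewrite (lt_trans _ p1). Qed.
Let pB : 0 < p - 1. Proof. by rewrite subr_gt0. Qed.
Let q1 : 1 < q. Proof. by rewrite /q ltr_pdivlMr// mul1r gtrBl. Qed.
Let q0 : 0 < q. Proof. exact: lt_trans q1. Qed.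
Let pq : p^-1 + q^-1 = 1. Proof. by rewrite /q; field; rewrite !gt_eqF. Qed.

Definition sinck_bound r x t : R := 2 `^ r * decay r (x - t).

Lemma sinck_powR_le r x t : 0 <= r -> `|sinck (x - t)| `^ r <= sinck_bound r x t.
Proof.
move=> r0; apply: (@le_trans _ _ ((2 * decay 1 (x - t)) `^ r)).
  by apply: ge0_ler_powR; rewrite ?nnegrE ?sinck_decay// mulr_ge0 ?decay_ge0.
by rewrite powRM ?decay_ge0// decay_pow mul1r.
Qed.

Lemma measurable_sinck_bound r x : measurable_fun [set: R] (sinck_bound r x).
Proof.
apply: measurable_funM => //.
by apply: (measurableT_comp (@measurable_decay R r)); apply: measurable_funB.
Qed.

Lemma integral_sinck_bound r x : 1 < r ->
  (\int[leb]_t (sinck_bound r x t)%:E = (2 `^ r * (2 / (r - 1)))%:E)%E.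
Proof.
move=> r1; under eq_integral do rewrite EFinM.
rewrite ge0_integralZl_EFin//.
- by rewrite integral_decayC// -EFinM.
- by move=> t _; rewrite lee_fin decay_ge0.
- apply/measurable_EFinP.
  by apply: (measurableT_comp (@measurable_decay R r)); apply: measurable_funB.
Qed.

Lemma integral_sinck_powR (r t : R) : 1 < r ->
  (\int[leb]_x (`|sinck (x - t)| `^ r)%:E <= (2 `^ r * (2 / (r - 1)))%:E)%E.
Proof.
move=> r1; have r0 : 0 <= r by lra.
rewrite -(integral_sinck_bound t r1); apply: ge0_le_integral => //.
- apply: measurable_powRnorm; apply: (measurableT_comp measurable_sinck).
  exact: measurable_funB.
- by apply/measurable_EFinP; exact: measurable_sinck_bound.
- move=> x _; rewrite lee_fin -sinckN opprB; exact: sinck_powR_le.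
Qed.

(** Young's inequality for products: this dominating function shows that the
    integral which defines the multiplier converges at every point for f in Lp.
    *)
Lemma sinck_dominated f x t :
  `|f t * sinck (x - t)| <= `|f t| `^ p + sinck_bound q x t.
Proof.
rewrite normrM.
apply: le_trans (@conjugate_powR _ _ _ p q (normr_ge0 _) (normr_ge0 _) p0 q0 pq) _.
apply: lerD; first by rewrite ler_piMr ?powR_ge0// invf_le1// ltW.
apply: le_trans (sinck_powR_le x t (ltW q0)).
by rewrite ler_piMr ?powR_ge0// invf_le1// ltW.
Qed.

Lemma integrable_dominant f x : measurable_fun [set: R] f ->
  (\int[leb]_x (`|f x| `^ p)%:E < +oo)%E ->
  leb.-integrable [set: R] (EFin \o (fun t => `|f t| `^ p + sinck_bound q x t)).
Proof.
move=> mf fp.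
have i1 : leb.-integrable [set: R] (fun t => (`|f t| `^ p)%:E).
  apply/integrableP; split; first exact: measurable_powRnorm.
  by under eq_integral => t _ do rewrite gee0_abs ?lee_fin ?powR_ge0//.
have i2 : leb.-integrable [set: R] (fun t => (sinck_bound q x t)%:E).
  apply/integrableP; split; first by apply/measurable_EFinP; exact: measurable_sinck_bound.
  under eq_integral => t _ do rewrite gee0_abs ?lee_fin ?mulr_ge0 ?powR_ge0//.
  by rewrite integral_sinck_bound// ltry.
by have := integrableD measurableT i1 i2.
Qed.

Lemma integrable_sinck f x : measurable_fun [set: R] f ->
  (\int[leb]_x (`|f x| `^ p)%:E < +oo)%E ->
  leb.-integrable [set: R] (EFin \o (fun t => f t * sinck (x - t))).
Proof.
move=> mf fp; apply: le_integrable (integrable_dominant x mf fp) => //.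
- by apply/measurable_EFinP; apply: measurable_funM => //; exact: measurable_sinckB.
- move=> t _; rewrite /= lee_fin; apply: le_trans (sinck_dominated f x t) _.
  exact: ler_norm.
Qed.

(** The function f is truncated to |t| <= n and |f(t)| <= n; the multiplier of
    the truncations converges at every point by dominated convergence, and
    Fatou's lemma transfers the bound. *)
Lemma riesz_Sop : exists2 C : R, 0 <= C & forall f, measurable_fun [set: R] f ->
  (\int[leb]_x (`|f x| `^ p)%:E < +oo)%E ->
  (\int[leb]_x (`|Sop f x| `^ p)%:E <= C%:E * \int[leb]_x (`|f x| `^ p)%:E)%E.
Proof.
have [C C0 HC] := riesz_Sop_bcs p1; exists C => // f mf fp.
pose D n : set R := `[- n%:R, n%:R]%classic `&` f @^-1` `[- n%:R, n%:R]%classic.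
have mD n : measurable (D n).
  apply: measurableI; first exact: measurable_itv.
  by rewrite -[X in measurable X]setTI; apply: mf => //; exact: measurable_itv.
pose fn n t := f t * \1_(D n) t.
have m1 n : measurable_fun [set: R] (\1_(D n) : R -> R) by exact: measurable_indic.
have mfn n : measurable_fun [set: R] (fn n) by exact: measurable_funM.
have DE n t : \1_(D n) t = ((`|t| <= n%:R) && (`|f t| <= n%:R))%R%:R :> R.
  rewrite indicE (_ : (t \in D n) = (`|t| <= n%:R) && (`|f t| <= n%:R))//.
  rewrite !ler_norml; apply/idP/idP; rewrite inE /D/= !in_itv/=.
    by case=> -> ->.
  by case/andP.
have fnle n t : `|fn n t| <= `|f t|.
  by rewrite /fn normrM DE normr_nat; case: (_ && _); rewrite /= ?mulr1 ?mulr0.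
have bfn n : bcs (fn n).
  split => //; exists n%:R, n%:R => t; rewrite /fn normrM DE normr_nat.
  by case: (`|t| <= _); case: (leP `|f t| n%:R) => /= tn; rewrite ?mulr1n ?mulr0n ?mulr1 ?mulr0.
have fncvg t : fn n t @[n --> \oo] --> f t.
  apply: cvg_near_cst; near=> n; rewrite /fn DE.
  have -> : `|t| <= n%:R by near: n; exact: nbhs_infty_ger.
  have -> : `|f t| <= n%:R by near: n; exact: nbhs_infty_ger.
  by rewrite mulr1.
have Scvg x : Sop (fn n) x @[n --> \oo] --> Sop f x.
  have iS := integrable_sinck x mf fp.
  apply: fine_cvg; rewrite fineK; last exact: (integrable_fin_num (mu := leb) measurableT iS).
  apply: (@dominated_cvg _ _ _ leb _ measurableT
    (fun n t => (fn n t * sinck (x - t))%:E) _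
    (EFin \o (fun t => `|f t| `^ p + sinck_bound q x t))) => //.
  - move=> n; apply/measurable_EFinP.
    exact: (measurable_funM (mfn n) (measurable_sinckB x)).
  - move=> t _; apply: cvg_EFin; first exact: nearW.
    by apply: cvgM; [exact: fncvg|exact: cvg_cst].
  - exact: integrable_dominant.
  - move=> n t _; rewrite lee_fin; apply: le_trans (sinck_dominated f x t).
    by rewrite [leLHS]normrM [leRHS]normrM ler_wpM2r.
apply: (@fatou_le _ _ R leb (fun n x => (`|Sop (fn n) x| `^ p)%:E)).
- by move=> n; apply: measurable_powRnorm; exact: measurable_Sop.
- by move=> n x; rewrite lee_fin powR_ge0.
- by move=> x; apply: cvg_EFin; [exact: nearW|exact: cvg_normr_powR].
move=> e e0; apply: nearW => n.
apply: le_trans (leeDl _ _); last by rewrite lee_fin ltW.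
apply: le_trans (HC _ (bfn n)) _; apply: lee_wpmul2l; first by rewrite lee_fin.
apply: ge0_le_integral => //; try exact: measurable_powRnorm.
by move=> x _; rewrite lee_fin; apply: ge0_ler_powR; rewrite ?nnegrE// ltW.
Unshelve. all: by end_near. Qed.

(** Here the weight of the weighted Jensen inequality is |f|, and the kernel
    contributes the integral of |sin t / t|^p, finite for p > 1. *)
Lemma young_Sop f (A : R) : measurable_fun [set: R] f ->
  (\int[leb]_x (`|f x|)%:E <= A%:E)%E ->
  (\int[leb]_x (`|Sop f x| `^ p)%:E <= (2 `^ p * (2 / (p - 1)) * A `^ p)%:E)%E.
Proof.
move=> mf fA; pose K := 2 `^ p * (2 / (p - 1)).
have K0 : 0 <= K by rewrite mulr_ge0 ?powR_ge0// divr_ge0// ltW.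
have A0 : 0 <= A.
  rewrite -lee_fin; apply: le_trans fA; apply: integral_ge0 => x _; by rewrite lee_fin.
have ma : measurable_fun [set: R * R] (fun z : R * R => `|f z.2|).
  by apply: measurableT_comp => //; apply: (measurableT_comp mf).
have mb : measurable_fun [set: R * R] (fun z : R * R => `|sinck (z.1 - z.2)|).
  apply: measurableT_comp => //; apply: (measurableT_comp measurable_sinck).
  exact: measurable_funB.
have H := @integral_power_kernel _ _ _ _ R leb leb _ _ p A p1 ma mb
  (fun z => normr_ge0 _) (fun z => normr_ge0 _) (fun=> fA).
apply: (@le_trans _ _ (\int[leb]_x ((\int[leb]_t (`|f t| * `|sinck (x - t)|)%:E) `^ p))%E).
  apply: ge0_le_integral => //.
  - by apply: measurable_powRnorm; exact: measurable_Sop.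
  - apply: (measurableT_comp (measurable_poweR p)).
    apply: (@measurable_fun_fubini_tonelli_F _ _ _ _ _ leb
      (fun z : R * R => (`|f z.2| * `|sinck (z.1 - z.2)|)%:E)) => //.
    by apply/measurable_EFinP; exact: measurable_funM.
  - move=> x _; rewrite -poweR_EFin; apply: gt0_ler_poweR.
    + exact: ltW.
    + by rewrite in_itv/= lee_fin normr_ge0 leey.
    + by rewrite in_itv/= leey andbT; apply: integral_ge0.
    + apply: abs_Rintegral_le => //.
      * by apply: measurable_funM => //; exact: measurable_sinckB.
      * apply: measurable_funM; first exact: measurableT_comp.
        by apply: measurableT_comp => //; exact: measurable_sinckB.
      * by move=> t; rewrite normrM.
apply: le_trans H _.
have mk t : measurable_fun [set: R] (fun x => (`|sinck (x - t)| `^ p)%:E).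
  apply: measurable_powRnorm; apply: (measurableT_comp measurable_sinck).
  exact: measurable_funB.
apply: (@le_trans _ _ ((A `^ (p - 1))%:E * \int[leb]_t (`|f t|%:E * K%:E))%E).
  apply: lee_wpmul2l; first by rewrite lee_fin powR_ge0.
  apply: ge0_le_integral => //.
  - by move=> t _; apply: integral_ge0 => x _; rewrite lee_fin mulr_ge0 ?powR_ge0.
  - apply: (@measurable_fun_fubini_tonelli_G _ _ _ _ _ leb
      (fun z : R * R => (`|f z.2| * `|sinck (z.1 - z.2)| `^ p)%:E)) => //.
    + apply/measurable_EFinP; apply: measurable_funM => //.
      exact: (measurableT_comp (@measurable_powR R p)).
  - apply: emeasurable_funM => //; apply/measurable_EFinP; exact: measurableT_comp.
  - move=> t _ /=; under eq_integral do rewrite EFinM.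
    rewrite ge0_integralZl_EFin//.
      by apply: lee_wpmul2l; [rewrite lee_fin|exact: integral_sinck_powR].
    exact: mk.
rewrite ge0_integralZr//; last first.
  by apply/measurable_EFinP; exact: measurableT_comp.
apply: (@le_trans _ _ ((A `^ (p - 1))%:E * (A%:E * K%:E))%E).
  apply: lee_wpmul2l; first by rewrite lee_fin powR_ge0.
  by apply: lee_wpmul2r; first by rewrite lee_fin.
rewrite -!EFinM lee_fin -/K -(mulr_powRB1 A0 p0).
by rewrite le_eqVlt; apply/orP; left; apply/eqP; ring.
Qed.

End fixed_exponent.
End extension.

(** * Complex-valued functions *)

Section complex_valued.
Context {R : realType}.
Implicit Types (f g u : R -> R[i]) (p x y : R) (z w : R[i]).

Lemma cmodE z : cmod z = Num.sqrt (complex.Re z ^+ 2 + complex.Im z ^+ 2).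
Proof. by case: z. Qed.

Lemma cmod_ge0 z : 0 <= cmod z.
Proof. by rewrite cmodE sqrtr_ge0. Qed.

Lemma normr_Re_le z : `|complex.Re z| <= cmod z.
Proof. by rewrite cmodE -sqrtr_sqr ler_wsqrtr// lerDl sqr_ge0. Qed.

Lemma normr_Im_le z : `|complex.Im z| <= cmod z.
Proof. by rewrite cmodE -sqrtr_sqr ler_wsqrtr// lerDr sqr_ge0. Qed.

Lemma cmod_le_ReIm z : cmod z <= `|complex.Re z| + `|complex.Im z|.
Proof.
rewrite cmodE -[leRHS]ger0_norm ?addr_ge0// -sqrtr_sqr ler_wsqrtr//.
rewrite sqrrD !real_normK ?num_real// lerD2r lerDl mulrn_wge0// mulr_ge0//.
Qed.

Lemma cmodD z w : cmod (z + w) <= cmod z + cmod w.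
Proof. exact: le_normcD. Qed.

Lemma measurable_cmod f :
  measurable_fun [set: R] (fun x => complex.Re (f x)) ->
  measurable_fun [set: R] (fun x => complex.Im (f x)) ->
  measurable_fun [set: R] (cmod \o f).
Proof.
move=> mr mi.
have -> : cmod \o f = fun x => (complex.Re (f x) ^+ 2 + complex.Im (f x) ^+ 2) `^ 2^-1.
  by apply/funext => x; rewrite /= cmodE powR12_sqrt// addr_ge0 ?sqr_ge0.
apply: (measurableT_comp (@measurable_powR R _)).
by apply: measurable_funD; exact: measurable_funX.
Qed.

Lemma LpP (p : \bar R) f : Lp p f <->
  [/\ measurable_fun [set: R] (fun x => complex.Re (f x)),
      measurable_fun [set: R] (fun x => complex.Im (f x)) & (Lp_norm p f < +oo)%E].
Proof.
split=> [[mr mi]|[mr mi fp]].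
  by rewrite inE => /andP[_]; rewrite inE.
split => //; rewrite inE; apply/andP; split; rewrite inE//=.
exact: measurable_cmod.
Qed.

Lemma Lnorm_EFinE p (c : R -> R) :
  'N[leb]_p%:E[EFin \o c]%E = ((\int[leb]_x (`|c x| `^ p)%:E) `^ p^-1)%E.
Proof. by rewrite unlock; congr (_ `^ _)%E; apply: eq_integral. Qed.

Lemma Lp_normE p f : Lp_norm p%:E f = ((\int[leb]_x (cmod (f x) `^ p)%:E) `^ p^-1)%E.
Proof.
rewrite /Lp_norm unlock; congr (_ `^ _)%E; apply: eq_integral => x _ /=.
by rewrite ger0_norm// cmod_ge0.
Qed.

Lemma Lp_norm1E f : Lp_norm 1%:E f = (\int[leb]_x (cmod (f x))%:E)%E.
Proof.
by rewrite /Lp_norm Lnorm1; apply: eq_integral => x _ /=; rewrite ger0_norm// cmod_ge0.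
Qed.

Lemma Lp_norm_ge0 (p : \bar R) f : (0 <= Lp_norm p f)%E.
Proof. exact: Lnorm_ge0. Qed.

(** Passage from a bound between p-th powers of norms to a bound between norms.
    *)
Lemma poweR_le_root (I J : \bar R) (K p : R) : 0 < p -> 0 <= K ->
  (0 <= I)%E -> (0 <= J)%E -> (I <= K%:E * J)%E ->
  (I `^ p^-1 <= (K `^ p^-1)%:E * J `^ p^-1)%E.
Proof.
move=> p0 K0 I0 J0 IJ.
rewrite -poweR_EFin -poweRM//.
apply: gt0_ler_poweR => //; first by rewrite invr_ge0 ltW.
  by rewrite in_itv/= I0 leey.
by rewrite in_itv/= leey andbT mule_ge0.
Qed.

Lemma Lp_powR_lty p f : 0 < p -> Lp p%:E f -> (\int[leb]_x (cmod (f x) `^ p)%:E < +oo)%E.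
Proof.
move=> p0 /LpP[_ _]; rewrite Lp_normE; apply: lty_poweRy.
by rewrite invr_neq0// gt_eqF.
Qed.

Section components.
Variables (p : R) (f : R -> R[i]).
Hypothesis p1 : 1 < p.
Let p0 : 0 < p. Proof. exact: lt_trans p1. Qed.
Let a x := complex.Re (f x).
Let b x := complex.Im (f x).

Lemma le_integral_component (c : R -> R) : measurable_fun [set: R] a ->
  measurable_fun [set: R] b ->
  measurable_fun [set: R] c -> (forall x, `|c x| <= cmod (f x)) ->
  (\int[leb]_x (`|c x| `^ p)%:E <= \int[leb]_x (cmod (f x) `^ p)%:E)%E.
Proof.
move=> ma mb mc cf; apply: ge0_le_integral => //.
- exact: measurable_powRnorm.
- apply/measurable_EFinP; apply: (measurableT_comp (@measurable_powR R p)).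
  exact: measurable_cmod.
- move=> x _; rewrite lee_fin; apply: ge0_ler_powR; rewrite ?nnegrE ?cmod_ge0//.
  exact: ltW.
Qed.

Lemma integral_cmod_le : measurable_fun [set: R] a -> measurable_fun [set: R] b ->
  (\int[leb]_x (cmod (f x) `^ p)%:E <=
   (2 `^ p)%:E * (\int[leb]_x (`|a x| `^ p)%:E + \int[leb]_x (`|b x| `^ p)%:E))%E.
Proof.
move=> ma mb; have mc : measurable_fun [set: R] (cmod \o f) by exact: measurable_cmod.
apply: le_trans (integral_powR_le2 p0 mc ma mb _).
  by rewrite le_eqVlt; apply/orP; left; apply/eqP; apply: eq_integral => x _ /=;
    rewrite ger0_norm ?cmod_ge0.
by move=> x /=; rewrite ger0_norm ?cmod_ge0// cmod_le_ReIm.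
Qed.

End components.

(** The kernel is real, so that the operator acts separately on the real and
    imaginary parts. *)
Definition segment f x : R[i] :=
  Sop (fun y => complex.Re (f y)) x +i* Sop (fun y => complex.Im (f y)) x.

Lemma measurable_Re_segment f : measurable_fun [set: R] (fun x => complex.Re (f x)) ->
  measurable_fun [set: R] (fun x => complex.Re (segment f x)).
Proof. exact: measurable_Sop. Qed.

Lemma measurable_Im_segment f : measurable_fun [set: R] (fun x => complex.Im (f x)) ->
  measurable_fun [set: R] (fun x => complex.Im (segment f x)).
Proof. exact: measurable_Sop. Qed.

Definition segment_integrable f x :=
  leb.-integrable [set: R] (EFin \o (fun t => complex.Re (f t) * sinck (x - t))) /\
  leb.-integrable [set: R] (EFin \o (fun t => complex.Im (f t) * sinck (x - t))).

Lemma segment_multE f x : segment_integrable f x -> segment_mult f x (segment f x).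
Proof.
move=> [ir ii]; rewrite /segment_mult.
have rE y : complex.Re ((sin (x - y) / (x - y))%:C * f y) = complex.Re (f y) * sinck (x - y).
  by case: (f y) => c d /=; rewrite mul0r subr0 mulrC.
have iE y : complex.Im ((sin (x - y) / (x - y))%:C * f y) = complex.Im (f y) * sinck (x - y).
  by case: (f y) => c d /=; rewrite mul0r addr0 mulrC.
split.
  split; [move: ir|move: ii]; apply: eq_integrable => // y _ /=; by rewrite ?rE ?iE.
by congr (_ +i* _); apply: eq_Rintegral => y _; rewrite ?rE ?iE.
Qed.

Lemma segment_Lp p : 1 < p -> exists2 C : R, 0 <= C & forall f, Lp p%:E f ->
  [/\ forall x, segment_integrable f x, Lp p%:E (segment f) &
      (Lp_norm p%:E (segment f) <= C%:E * Lp_norm p%:E f)%E].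
Proof.
move=> p1; have p0 : 0 < p by exact: lt_trans p1.
have [C C0 HC] := riesz_Sop p1.
pose K := 2 `^ p * (C + C).
have K0 : 0 <= K by rewrite mulr_ge0 ?powR_ge0 ?addr_ge0.
exists (K `^ p^-1); first exact: powR_ge0.
move=> f lf; have [mr mi _] := (LpP _ _).1 lf.
have fp := Lp_powR_lty p0 lf.
have lr := le_integral_component p1 mr mi mr (fun x => normr_Re_le (f x)).
have li := le_integral_component p1 mr mi mi (fun x => normr_Im_le (f x)).
have rp := le_lt_trans lr fp; have ip := le_lt_trans li fp.
have I0 : (0 <= \int[leb]_x (cmod (f x) `^ p)%:E)%E.
  by apply: integral_ge0 => x _; rewrite lee_fin powR_ge0.
have H : (Lp_norm p%:E (segment f) <= (K `^ p^-1)%:E * Lp_norm p%:E f)%E.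
  rewrite !Lp_normE; apply: (poweR_le_root p0 K0 _ I0).
    by apply: integral_ge0 => x _; rewrite lee_fin powR_ge0.
  apply: le_trans (integral_cmod_le p1 (measurable_Re_segment mr) (measurable_Im_segment mi)) _.
  rewrite EFinM -muleA; apply: lee_wpmul2l; first by rewrite lee_fin powR_ge0.
  rewrite EFinD ge0_muleDl ?lee_fin//.
  apply: leeD.
    apply: le_trans (HC _ mr rp) _.
    by apply: lee_wpmul2l; [rewrite lee_fin|exact: lr].
  apply: le_trans (HC _ mi ip) _.
  by apply: lee_wpmul2l; [rewrite lee_fin|exact: li].
split => //.
- by move=> x; split; exact: (integrable_sinck p1).
- apply/LpP; split; [exact: measurable_Re_segment|exact: measurable_Im_segment|].
  apply: le_lt_trans H _; have [_ _ fn] := (LpP _ _).1 lf.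
  by apply: lte_mul_pinfty => //; rewrite lee_fin powR_ge0.
Qed.

Lemma segment_L1 p : 1 < p -> exists2 C : R, 0 <= C & forall f, Lp 1%:E f ->
  [/\ forall x, segment_integrable f x, Lp p%:E (segment f) &
      (Lp_norm p%:E (segment f) <= C%:E * Lp_norm 1%:E f)%E].
Proof.
move=> p1; have p0 : 0 < p by exact: lt_trans p1.
pose K := 2 `^ p * (2 / (p - 1)).
have K0 : 0 <= K by rewrite mulr_ge0 ?powR_ge0// divr_ge0// subr_ge0 ltW.
pose K2 := 2 `^ p * (K + K).
have K20 : 0 <= K2 by rewrite mulr_ge0 ?powR_ge0 ?addr_ge0.
exists (K2 `^ p^-1); first exact: powR_ge0.
move=> f lf; have [mr mi fn] := (LpP _ _).1 lf.
have mc := measurable_cmod mr mi.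
have n0 := Lp_norm_ge0 1%:E f.
have fnE : Lp_norm 1%:E f \is a fin_num by rewrite ge0_fin_numE.
set A := fine (Lp_norm 1%:E f).
have AE : Lp_norm 1%:E f = A%:E by rewrite fineK.
have A0 : 0 <= A by rewrite fine_ge0.
have bnd (c : R -> R) : measurable_fun [set: R] c -> (forall x, `|c x| <= cmod (f x)) ->
    (\int[leb]_x (`|c x|)%:E <= A%:E)%E.
  move=> mf cf; rewrite -AE Lp_norm1E; apply: ge0_le_integral => //.
  - by apply/measurable_EFinP; exact: measurableT_comp.
  - exact/measurable_EFinP.
  - by move=> x _; rewrite lee_fin.
have lr := bnd _ mr (fun x => normr_Re_le (f x)).
have li := bnd _ mi (fun x => normr_Im_le (f x)).
have H : (Lp_norm p%:E (segment f) <= (K2 `^ p^-1)%:E * Lp_norm 1%:E f)%E.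
  have -> : Lp_norm 1%:E f = ((A `^ p)%:E `^ p^-1)%E.
    by rewrite AE poweR_EFin -powRrM divff ?gt_eqF// powRr1.
  rewrite Lp_normE; apply: (poweR_le_root p0 K20).
  - by apply: integral_ge0 => x _; rewrite lee_fin powR_ge0.
  - by rewrite lee_fin powR_ge0.
  apply: le_trans (integral_cmod_le p1 (measurable_Re_segment mr) (measurable_Im_segment mi)) _.
  rewrite EFinM -muleA; apply: lee_wpmul2l; first by rewrite lee_fin powR_ge0.
  rewrite EFinD ge0_muleDl ?lee_fin//.
  by apply: leeD; rewrite -EFinM; exact: young_Sop.
split => //.
- have key (c : R -> R) x : measurable_fun [set: R] c ->
      (\int[leb]_x (`|c x|)%:E <= A%:E)%E ->
      leb.-integrable [set: R] (EFin \o (fun t => c t * sinck (x - t))).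
    move=> m cA; apply/integrableP; split.
      by apply/measurable_EFinP; exact: (measurable_funM m (measurable_sinckB x)).
    apply: (@le_lt_trans _ _ A%:E); last exact: ltry.
    apply: le_trans cA; apply: ge0_le_integral => //.
    + apply: measurableT_comp => //; apply/measurable_EFinP.
      exact: (measurable_funM m (measurable_sinckB x)).
    + by apply/measurable_EFinP; exact: measurableT_comp.
    + by move=> t _; rewrite /= lee_fin normrM ler_piMr// sinck_le1.
  by move=> x; split; exact: key.
- apply/LpP; split; [exact: measurable_Re_segment|exact: measurable_Im_segment|].
  apply: le_lt_trans H _.
  by apply: lte_mul_pinfty => //; rewrite lee_fin powR_ge0.
Qed.

(** Hoelder's inequality: the kernel is in Lq for the conjugate exponent q > 1,
    with a norm that does not depend on the translation. *)
Lemma segment_pointwise p : 1 < p -> exists2 C : R, 0 <= C & forall f x, Lp p%:E f ->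
  ((cmod (segment f x))%:E <= C%:E * Lp_norm p%:E f)%E.
Proof.
move=> p1; have p0 : 0 < p by exact: lt_trans p1.
pose q := p / (p - 1).
have q1 : 1 < q by rewrite /q ltr_pdivlMr; lra.
have q0 : 0 < q by lra.
have pq : p^-1 + q^-1 = 1 by rewrite /q; field; rewrite !gt_eqF//; lra.
pose K := (2 `^ q * (2 / (q - 1))) `^ q^-1.
have K0 : 0 <= K by exact: powR_ge0.
exists (K + K); first by rewrite addr_ge0.
move=> f x lf; have [mr mi _] := (LpP _ _).1 lf.
have mk := measurable_sinckB x.
have kN : ('N[leb]_q%:E[EFin \o (fun t => sinck (x - t))] <= K%:E)%E.
  rewrite Lnorm_EFinE /K -poweR_EFin; apply: gt0_ler_poweR.
  - by rewrite invr_ge0 ltW.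
  - by rewrite in_itv/= leey andbT integral_ge0// => t _; rewrite lee_fin powR_ge0.
  - by rewrite in_itv/= leey andbT lee_fin mulr_ge0 ?powR_ge0// divr_ge0//; lra.
  rewrite -(integral_sinck_bound x q1); apply: ge0_le_integral => //.
  - by apply: (@measurable_powRnorm R q); exact: measurable_sinckB.
  - by apply/measurable_EFinP; exact: measurable_sinck_bound.
  - by move=> t _; rewrite lee_fin; apply: sinck_powR_le; exact: ltW.
have key (c : R -> R) : measurable_fun [set: R] c -> (forall x, `|c x| <= cmod (f x)) ->
    (`|Sop c x|%:E <= K%:E * Lp_norm p%:E f)%E.
  move=> mc cf.
  apply: (@le_trans _ _ ('N[leb]_1[EFin \o (c \* (fun t => sinck (x - t)))%R])%E).
    rewrite Lnorm1; apply: abs_Rintegral_le => //.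
    - exact: measurable_funM.
    - by apply: measurableT_comp => //; exact: measurable_funM.
  apply: le_trans (hoelder leb mc mk p0 q0 pq) _.
  rewrite muleC; apply: lee_pmul => //; try exact: Lnorm_ge0.
  rewrite Lnorm_EFinE Lp_normE; apply: gt0_ler_poweR.
  - by rewrite invr_ge0 ltW.
  - by rewrite in_itv/= leey andbT integral_ge0// => t _; rewrite lee_fin powR_ge0.
  - by rewrite in_itv/= leey andbT integral_ge0// => t _; rewrite lee_fin powR_ge0.
  exact: le_integral_component.
apply: (@le_trans _ _ (`|Sop (fun y => complex.Re (f y)) x|%:E + `|Sop (fun y => complex.Im (f y)) x|%:E)%E).
  by rewrite -EFinD lee_fin; exact: cmod_le_ReIm.
rewrite EFinD ge0_muleDl ?lee_fin//.
by apply: leeD; apply: key => // y; [exact: normr_Re_le|exact: normr_Im_le].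
Qed.

End complex_valued.

(** * The segment multiplier is bounded *)

Section segment_bounded.
Context {R : realType}.
Implicit Types (f g h u : R -> R[i]) (p x y : R).

Lemma Lp_normD p f g : 1 <= p ->
  measurable_fun [set: R] (fun x => complex.Re (f x)) ->
  measurable_fun [set: R] (fun x => complex.Im (f x)) ->
  measurable_fun [set: R] (fun x => complex.Re (g x)) ->
  measurable_fun [set: R] (fun x => complex.Im (g x)) ->
  (Lp_norm p%:E (fun x => f x + g x)%R <= Lp_norm p%:E f + Lp_norm p%:E g)%E.
Proof.
move=> p1 fr fi gr gi; have p0 : 0 < p by lra.
have mf := measurable_cmod fr fi; have mg := measurable_cmod gr gi.
have p1E : (1 <= p%:E)%E by rewrite lee_fin.
apply: le_trans (eminkowski leb mf mg p1E).
rewrite Lnorm_EFinE Lp_normE; apply: gt0_ler_poweR.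
- by rewrite invr_ge0 ltW.
- by rewrite in_itv/= leey andbT integral_ge0// => t _; rewrite lee_fin powR_ge0.
- by rewrite in_itv/= leey andbT integral_ge0// => t _; rewrite lee_fin powR_ge0.
apply: ge0_le_integral => //.
- by move=> x _; rewrite lee_fin powR_ge0.
- apply/measurable_EFinP; apply: (measurableT_comp (@measurable_powR R p)).
  apply: (measurable_cmod (f := fun x => f x + g x)).
  + have -> : (fun x => complex.Re (f x + g x)) = (fun x => complex.Re (f x) + complex.Re (g x)).
      by apply/funext => x; case: (f x) (g x) => ? ? [].
    exact: measurable_funD.
  + have -> : (fun x => complex.Im (f x + g x)) = (fun x => complex.Im (f x) + complex.Im (g x)).
      by apply/funext => x; case: (f x) (g x) => ? ? [].
    exact: measurable_funD.
- by apply: measurable_powRnorm; exact: measurable_funD.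
- move=> x _; rewrite lee_fin; apply: ge0_ler_powR; rewrite ?nnegrE ?cmod_ge0//; first exact: ltW.
  by rewrite /= ger0_norm ?addr_ge0 ?cmod_ge0// cmodD.
Qed.

Lemma Lp_norm0 p : 0 < p -> Lp_norm p%:E (fun _ : R => 0 : R[i]) = 0%E.
Proof.
move=> p0; rewrite Lp_normE.
under eq_integral => x _.
  have -> : cmod (0 : R[i]) = 0 by exact: Normc.normc0.
  rewrite powR0 ?gt_eqF//.
  over.
by rewrite integral0 poweR0r// invr_neq0// gt_eqF.
Qed.

Lemma Lp0 p : 0 < p -> Lp p%:E (fun _ : R => 0 : R[i]).
Proof. by move=> p0; apply/LpP; split => //; rewrite Lp_norm0. Qed.

Lemma segmentD f g h x : segment_integrable g x -> segment_integrable h x ->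
  (forall x, f x = g x + h x) ->
  segment_integrable f x /\ segment f x = segment g x + segment h x.
Proof.
move=> [gr gi] [hr hi] fE.
have rE t : complex.Re (f t) * sinck (x - t) =
    complex.Re (g t) * sinck (x - t) + complex.Re (h t) * sinck (x - t).
  by rewrite fE -mulrDl; case: (g t) (h t) => ? ? [].
have iE t : complex.Im (f t) * sinck (x - t) =
    complex.Im (g t) * sinck (x - t) + complex.Im (h t) * sinck (x - t).
  by rewrite fE -mulrDl; case: (g t) (h t) => ? ? [].
split.
  split.
    by apply: eq_integrable (integrableD measurableT gr hr) => // t _ /=; rewrite rE.
  by apply: eq_integrable (integrableD measurableT gi hi) => // t _ /=; rewrite iE.
rewrite /segment /Sop; apply/eqP; rewrite eq_complex /=; apply/andP; split; apply/eqP.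
  by rewrite -RintegralD//; apply: eq_Rintegral => t _; rewrite rE.
by rewrite -RintegralD//; apply: eq_Rintegral => t _; rewrite iE.
Qed.

(** Both L1 and Lp are mapped into Lp, so that Sf is its own Lp component in L1
    + Lp. The bound holds for every decomposition of f with the same Sf, hence
    with the infimum. *)
Theorem segment_bounded_sum p : 1 < p ->
  bounded_on (sumL1Lp p%:E) (sumL1Lp_norm p%:E) (@segment_mult R).
Proof.
move=> p1; have p0 : 0 < p by exact: lt_trans p1.
have [C1 C10 H1] := segment_L1 p1; have [C2 C20 H2] := segment_Lp p1.
pose C := C1 + C2 + 1; have C0 : 0 < C by rewrite ltr_wpDl// addr_ge0.
exists C => f [g [h [lg lh fE]]].
have dec g' h' : Lp 1%:E g' -> Lp p%:E h' -> (forall x, f x = g' x + h' x) ->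
    [/\ forall x, segment_integrable f x, Lp p%:E (segment f) &
     (Lp_norm p%:E (segment f) <= C%:E * (Lp_norm 1%:E g' + Lp_norm p%:E h'))%E].
  move=> lg' lh' fE'; have [ig Lg Ng] := H1 _ lg'; have [ih Lh Nh] := H2 _ lh'.
  have sE : segment f = (fun x => segment g' x + segment h' x).
    by apply/funext => x; have [] := segmentD (ig x) (ih x) fE'.
  have i x : segment_integrable f x by have [] := segmentD (ig x) (ih x) fE'.
  have [gr gi fng] := (LpP _ _).1 Lg; have [hr hi fnh] := (LpP _ _).1 Lh.
  have N : (Lp_norm p%:E (segment f) <=
      Lp_norm p%:E (segment g') + Lp_norm p%:E (segment h'))%E.
    by rewrite sE; apply: Lp_normD => //; exact: ltW.
  split => //.
    have [fr' fi' _] := (LpP _ _).1 lg'; have [hr' hi' _] := (LpP _ _).1 lh'.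
    apply/LpP; split; last by apply: le_lt_trans N _; exact: lte_add_pinfty.
      apply: measurable_Re_segment.
      have -> : (fun x => complex.Re (f x)) = (fun x => complex.Re (g' x) + complex.Re (h' x)).
        by apply/funext => x; rewrite fE'; case: (g' x) (h' x) => ? ? [].
      exact: measurable_funD.
    apply: measurable_Im_segment.
    have -> : (fun x => complex.Im (f x)) = (fun x => complex.Im (g' x) + complex.Im (h' x)).
      by apply/funext => x; rewrite fE'; case: (g' x) (h' x) => ? ? [].
    exact: measurable_funD.
  apply: le_trans N _; rewrite ge0_muleDr ?Lp_norm_ge0//; apply: leeD.
    apply: le_trans Ng _; apply: lee_wpmul2r; first exact: Lp_norm_ge0.
    by rewrite lee_fin /C; lra.
  apply: le_trans Nh _; apply: lee_wpmul2r; first exact: Lp_norm_ge0.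
  by rewrite lee_fin /C; lra.
have [i Ls _] := dec _ _ lg lh fE.
exists (segment f); split.
- exists (fun=> 0), (segment f); split => //; first exact: Lp0.
  by move=> x; rewrite add0r.
- by apply: aeW => x; exact: segment_multE.
- apply: (@le_trans _ _ (Lp_norm p%:E (segment f))).
    apply: ereal_inf_lbound; exists (fun=> 0), (segment f); split => //.
    + exact: Lp0.
    + by move=> x; rewrite add0r.
    + by rewrite Lp_norm0// add0e.
  rewrite -[leLHS]mul1e -(@mulfV _ C) ?gt_eqF// EFinM -muleA.
  apply: lee_wpmul2l; first by rewrite lee_fin ltW.
  apply: le_ereal_inf_tmp => _ [g' [h' [lg' lh' fE' ->]]].
  have [_ _ N] := dec _ _ lg' lh' fE'.
  apply: (@le_trans _ _ (C^-1%:E * (C%:E * (Lp_norm 1%:E g' + Lp_norm p%:E h')))%E).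
    by apply: lee_wpmul2l => //; rewrite lee_fin invr_ge0 ltW.
  by rewrite muleA -EFinM mulVf ?gt_eqF// mul1e.
Qed.

(** The Lp norm of f controls both the Lp norm and the supremum of Sf. *)
Theorem segment_bounded_cap p : 1 < p ->
  bounded_on (capLpLoo p%:E) (capLpLoo_norm p%:E) (@segment_mult R).
Proof.
move=> p1; have p0 : 0 < p by exact: lt_trans p1.
have [C1 C10 H1] := segment_Lp p1; have [C2 C20 H2] := segment_pointwise p1.
exists (C1 + C2) => f [lf _].
have [i Ls Ns] := H1 _ lf.
have [sr si _] := (LpP _ _).1 Ls; have [_ _ fn] := (LpP _ _).1 lf.
have Noo : (Lp_norm +oo%E (segment f) <= C2%:E * Lp_norm p%:E f)%E.
  have Y0 : (0 <= C2%:E * Lp_norm p%:E f)%E.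
    by apply: mule_ge0; [rewrite lee_fin|exact: Lp_norm_ge0].
  have HY x := H2 f x lf.
  move: (C2%:E * Lp_norm p%:E f)%E Y0 HY => Y Y0 HY.
  rewrite /Lp_norm unlock; case: ifPn => _ //.
  apply/ess_supP; apply: nearW => x /=.
  by rewrite ger0_norm ?cmod_ge0//; exact: HY.
exists (segment f); split.
- split => //; apply/LpP; split => //.
  apply: le_lt_trans Noo _.
  by apply: lte_mul_pinfty => //; rewrite lee_fin.
- by apply: aeW => x; exact: segment_multE.
- rewrite /capLpLoo_norm ge_max; apply/andP; split.
    apply: le_trans Ns _; apply: (@le_trans _ _ ((C1 + C2)%:E * Lp_norm p%:E f)%E).
      by apply: lee_wpmul2r; [exact: Lp_norm_ge0|rewrite lee_fin; lra].
    by apply: lee_wpmul2l; [rewrite lee_fin addr_ge0|rewrite le_max lexx].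
  apply: le_trans Noo _; apply: (@le_trans _ _ ((C1 + C2)%:E * Lp_norm p%:E f)%E).
    by apply: lee_wpmul2r; [exact: Lp_norm_ge0|rewrite lee_fin; lra].
  by apply: lee_wpmul2l; [rewrite lee_fin addr_ge0|rewrite le_max lexx].
Qed.

End segment_bounded.

(** * The Hilbert transform is unbounded *)

Section hilbert_box.
Context {R : realType}.
Implicit Types (k d p x y : R).

(** The function k on [0, d]. With k = 1 / d it has norm 1 in L1. *)
Definition box k d y : R[i] := (k * \1_(`[0, d]%classic : set R) y)%:C.

Lemma integral_inv_sub d x : 0 < d -> d < x ->
  (\int[leb]_(y in `[0%R, d]) ((x - y)^-1)%:E = (ln x - ln (x - d))%:E)%E.
Proof.
move=> d0 dx.
have dF y : y < x -> is_derive y 1 (fun y => - ln (x - y)) (x - y)^-1.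
  move=> yx; have xy : 0 < x - y by rewrite subr_gt0.
  have dl := @is_derive_comp R (@ln R) (fun y => x - y) y _ _ (is_derive1_ln xy)
    (is_deriveBr (is_derive_cstr y x) (is_derive_idr y)).
  have -> : (fun y => - ln (x - y)) = (fun y => -1 * ln (x - y)).
    by apply/funext => z; rewrite mulN1r.
  have /is_derive_eq := is_deriveZr (-1) dl.
  by apply; ring.
rewrite (@continuous_FTC2 _ _ (fun y => - ln (x - y)))//.
- by rewrite subr0 -EFinB opprK addrC.
- apply: derivable_within_continuous => y; rewrite in_itv/= => /andP[_ yd].
  have xy : x - y != 0 by rewrite gt_eqF// subr_gt0 (le_lt_trans yd).
  by case: (@is_deriveVr R (fun y => x - y) y _ xy
    (is_deriveBr (is_derive_cstr y x) (is_derive_idr y))).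
- split.
  + by move=> y; rewrite in_itv/= => /andP[_ yd]; case: (dF y (lt_trans yd dx)).
  + by apply: cvg_at_right_filter; exact: is_derive_continuous (dF 0 (lt_trans d0 dx)).
  + by apply: cvg_at_left_filter; exact: is_derive_continuous (dF d dx).
- move=> y; rewrite in_itv/= => /andP[_ yd].
  by rewrite derive1E; apply: (@derive_val _ _ _ _ _ _ _ (dF y (lt_trans yd dx))).
Qed.

Lemma ReB (z w : R[i]) : complex.Re (z - w) = complex.Re z - complex.Re w.
Proof. by case: z w => ? ? []. Qed.

(** To the right of d the singularity lies outside the support, so that the
    truncated integrals do not depend on the truncation once it is smaller than
    x - d; the uniqueness of the limit gives the value. *)
Lemma hilbert_box k d x (v : R[i]) : 0 < d -> d < x -> hilbert (box k d) x v ->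
  complex.Re v = k * (ln x - ln (x - d)).
Proof.
move=> d0 dx [_ H].
set c := k * _.
have ReE e : 0 < e -> e < x - d ->
    complex.Re (cintegral [set y : R | e < `|x - y|] (fun y => ((x - y)^-1)%:C * box k d y)) = c.
  move=> e0 ed; rewrite /cintegral /=.
  transitivity (\int[leb]_(y in `[0, d]) (k * (x - y)^-1)).
    rewrite [LHS]Rintegral_mkcond [RHS]Rintegral_mkcond; apply: eq_Rintegral => y _.
    rewrite !patchE /= !mul0r ?mulr0 subr0 indicE.
    have [yd|yd] := boolP (y \in (`[0, d]%classic : set R)); last first.
      by case: ifPn => // _; rewrite mulr0 mulr0.
    rewrite ifT ?mulr1 1?mulrC// inE /=.
    move: yd; rewrite inE/= in_itv/= => /andP[y0 yd].
    by rewrite gtr0_norm; lra.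
  have iV : leb.-integrable `[0, d] (EFin \o (fun y => (x - y)^-1)).
    apply: continuous_compact_integrable; first exact: segment_compact.
    apply: derivable_within_continuous => y; rewrite in_itv/= => /andP[_ yd].
    have xy : x - y != 0 by rewrite gt_eqF// subr_gt0 (le_lt_trans yd).
    by case: (@is_deriveVr R (fun y => x - y) y _ xy
      (is_deriveBr (is_derive_cstr y x) (is_derive_idr y))).
  rewrite RintegralZl// /c; congr (_ * _).
  by rewrite /Rintegral integral_inv_sub.
apply/eqP; rewrite -subr_eq0 -normr_le0 leNgt; apply/negP => n0.
move/cvgrPdist_lt : H => /(_ _ n0) H.
have dx0 : 0 < x - d by rewrite subr_gt0.
have : \forall e \near (0 : R)^'+, False.
  near=> e.
  have e0 : 0 < e by near: e; exact: nbhs_right_gt.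
  have ed : e < x - d by near: e; exact: nbhs_right_lt.
  have : `|0 - cmod (cintegral [set y : R | e < `|x - y|]
      (fun y => ((x - y)^-1)%:C * box k d y) - v)| < `|complex.Re v - c|.
    by near: e.
  rewrite sub0r normrN ger0_norm ?cmod_ge0// ltNge => /negP; apply.
  apply: le_trans (normr_Re_le _).
  have -> : complex.Re v - c = - (complex.Re (cintegral [set y : R | e < `|x - y|]
      (fun y => ((x - y)^-1)%:C * box k d y)) - complex.Re v) by rewrite ReE// opprB.
  by rewrite normrN ReB.
by case/filter_ex.
Unshelve. all: by end_near. Qed.

Lemma cmod_box k d y : 0 <= k -> cmod (box k d y) = k * \1_(`[0, d]%classic : set R) y.
Proof.
move=> k0; rewrite cmodE /= expr0n addr0 sqrtr_sqr ger0_norm// mulr_ge0//.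
Qed.

Lemma measurable_box k d :
  measurable_fun [set: R] (fun x => complex.Re (box k d x)) /\
  measurable_fun [set: R] (fun x => complex.Im (box k d x)).
Proof.
split => //=; apply: measurable_funM => //; apply: measurable_indic; exact: measurable_itv.
Qed.

Lemma integral_box_pow p k d : 0 < p -> 0 <= k -> 0 < d ->
  (\int[leb]_x (cmod (box k d x) `^ p)%:E = (k `^ p * d)%:E)%E.
Proof.
move=> p0 k0 d0.
transitivity (\int[leb]_(x in `[0%R, d]) (cst (k `^ p)%:E x))%E.
  rewrite [RHS]integral_mkcond; apply: eq_integral => x _.
  rewrite patchE cmod_box// indicE; case: ifPn => _; rewrite ?mulr1//.
  by rewrite mulr0 powR0// gt_eqF.
rewrite integral_cst; last exact: measurable_itv.
by rewrite /= lebesgue_measure_itv/= lte_fin d0 oppr0 addr0.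
Qed.

Lemma Lp_box p k d : 0 < p -> 0 <= k -> 0 < d -> Lp p%:E (box k d).
Proof.
move=> p0 k0 d0; have [mr mi] := measurable_box k d.
by apply/LpP; split => //; rewrite Lp_normE integral_box_pow// poweR_EFin ltry.
Qed.

Lemma norm1_box k d : 0 <= k -> 0 < d -> Lp_norm 1%:E (box k d) = (k * d)%:E.
Proof.
move=> k0 d0; rewrite Lp_normE integral_box_pow// poweR_EFin powRr1 //.
  by rewrite invr1 powRr1 // mulr_ge0 // ltW.
Qed.

Lemma Loo_box k d : 0 <= k -> 0 < d -> Lp +oo%E (box k d) /\
  (Lp_norm +oo%E (box k d) <= k%:E)%E.
Proof.
move=> k0 d0; have [mr mi] := measurable_box k d.
have H : (Lp_norm +oo%E (box k d) <= k%:E)%E.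
  rewrite /Lp_norm unlock; case: ifPn => _ //.
  apply/ess_supP; apply: nearW => x; change (`|cmod (box k d x)|%:E <= k%:E)%E.
  rewrite lee_fin ger0_norm ?cmod_ge0// cmod_box//.
  by rewrite ler_piMr// indicE; case: (_ \in _).
by split => //; apply/LpP; split => //; apply: le_lt_trans H _; exact: ltry.
Qed.

End hilbert_box.

Section hilbert_unbounded.
Context {R : realType}.
Implicit Types (p : R).

(** Hoelder's inequality on a set of measure at most 1. *)
Lemma integral_le_Lp_norm p (h : R -> R[i]) (e : R) : 1 < p -> 0 < e -> e < 1 ->
  Lp p%:E h ->
  (\int[leb]_(x in `]e, 1%R]) (cmod (h x))%:E <= Lp_norm p%:E h)%E.
Proof.
move=> p1 e0 e1 lh; have [hr hi _] := (LpP _ _).1 lh.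
have p0 : 0 < p by lra.
pose q := p / (p - 1).
have q0 : 0 < q by rewrite divr_gt0//; lra.
have pq : p^-1 + q^-1 = 1 by rewrite /q; field; rewrite !gt_eqF//; lra.
pose I : set R := `]e, 1%R]%classic.
have mI : measurable I by exact: measurable_itv.
have mind : measurable_fun [set: R] (\1_I : R -> R) by exact: measurable_indic.
have := hoelder leb (measurable_cmod hr hi) mind p0 q0 pq.
have -> : 'N[leb]_1[EFin \o ((cmod \o h) \* \1_I)%R]%E = (\int[leb]_(x in I) (cmod (h x))%:E)%E.
  rewrite Lnorm1 [RHS]integral_mkcond; apply: eq_integral => x _.
  rewrite patchE /= indicE ger0_norm; last by rewrite mulr_ge0 ?cmod_ge0.
  by case: ifPn => _; rewrite ?mulr1 ?mulr0.
move=> /le_trans; apply.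
rewrite -[leRHS]mule1; apply: lee_wpmul2l; first exact: Lnorm_ge0.
rewrite Lnorm_EFinE.
have -> : (\int[leb]_x (`|\1_I x| `^ q)%:E = (1 - e)%:E)%E.
  transitivity (\int[leb]_x (\1_I x)%:E)%E.
    apply: eq_integral => x _; rewrite indicE; case: (_ \in _).
      by rewrite normr1 powR1.
    by rewrite normr0 powR0// gt_eqF.
  rewrite integral_indic// setIT.
  have E := lebesgue_measure_itv `]e, 1%R].
  by rewrite /= lte_fin e1 -EFinB in E; exact: E.
rewrite poweR_EFin lee_fin.
apply: (@le_trans _ _ (1 `^ q^-1)); last by rewrite powR1.
by apply: ge0_ler_powR; rewrite ?nnegrE ?invr_ge0; lra.
Qed.

(** The functions equal to 1 / e on [0, e] have norm at most 1, while their
    transforms are at least 1 / x on ]e, 1]. For every decomposition g + h of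
    such a transform, the integral ln (1 / e) of 1 / x is at most the sum of the
    L1 norm of g and the Lp norm of h, so that it bounds the norm from below. *)
Theorem hilbert_unbounded_sum p : 1 < p ->
  ~ bounded_on (sumL1Lp p%:E) (sumL1Lp_norm p%:E) (@hilbert R).
Proof.
move=> p1 [C HC]; have p0 : 0 < p by lra.
(* with this width, ln (1 / e) exceeds |C| *)
pose e : R := expR (- (`|C| + 1)).
have e0 : 0 < e by exact: expR_gt0.
have e1 : e < 1 by rewrite expR_lt1 oppr_lt0 ltr_wpDl.
have eV0 : 0 <= e^-1 by rewrite invr_ge0 ltW.
pose f := box e^-1 e.
have l1 : Lp 1%:E f by exact: Lp_box.
have X : sumL1Lp p%:E f.
  by exists f, (fun=> 0); split => // [|x]; [exact: Lp0|rewrite addr0].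
have [u [_ Hu Nu]] := HC f X.
have Nf : (sumL1Lp_norm p%:E f <= 1%:E)%E.
  apply: ereal_inf_lbound; exists f, (fun=> 0); split => //.
  - exact: Lp0.
  - by move=> x; rewrite addr0.
  - by rewrite norm1_box// mulVf ?gt_eqF// Lp_norm0// adde0.
have Nf0 : (0 <= sumL1Lp_norm p%:E f)%E.
  apply: le_ereal_inf_tmp => _ [g [h [_ _ _ ->]]].
  by rewrite adde_ge0// Lp_norm_ge0.
have Nu1 : (sumL1Lp_norm p%:E u <= `|C|%:E)%E.
  apply: le_trans Nu _; apply: (@le_trans _ _ (`|C|%:E * sumL1Lp_norm p%:E f)%E).
    by apply: lee_wpmul2r => //; rewrite lee_fin ler_norm.
  by rewrite -[leRHS]mule1; apply: lee_wpmul2l; rewrite ?lee_fin.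
suff : (((`|C| + 1)%:E : \bar R) <= sumL1Lp_norm p%:E u)%E.
  by move=> /le_trans /(_ Nu1); rewrite lee_fin; lra.
apply: le_ereal_inf_tmp => _ [g [h [lg lh uE ->]]].
have [gr gi _] := (LpP _ _).1 lg; have [hr hi _] := (LpP _ _).1 lh.
have mg := measurable_cmod gr gi; have mh := measurable_cmod hr hi.
pose I : set R := `]e, 1%R]%classic.
have mI : measurable I by exact: measurable_itv.
have minv : measurable_fun I (fun x : R => (x^-1)%:E).
  by apply/measurable_EFinP; apply: measurable_funTS; exact: measurable_invr.
have -> : ((`|C| + 1)%:E = \int[leb]_(x in I) (x^-1)%:E)%E.
  rewrite /I integral_itv_obnd_cbnd; last exact: minv.
  rewrite (@continuous_FTC2 _ _ (@ln R))//.
  - by rewrite ln1 /e expRK -EFinB sub0r opprK.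
  - apply: derivable_within_continuous => x; rewrite in_itv/= => /andP[ex _].
    have x0 : x != 0 by rewrite gt_eqF// (lt_le_trans e0).
    by case: (@is_deriveVr R (fun y => y) x _ x0 (is_derive_idr x)).
  - split.
    + move=> x; rewrite in_itv/= => /andP[ex _].
      by case: (is_derive1_ln (lt_trans e0 ex)).
    + by apply: cvg_at_right_filter; exact: is_derive_continuous (is_derive1_ln e0).
    + by apply: cvg_at_left_filter; exact: is_derive_continuous (is_derive1_ln ltr01).
  - move=> x; rewrite in_itv/= => /andP[ex _]; rewrite derive1E.
    by apply: (@derive_val _ _ _ _ _ _ _ (is_derive1_ln (lt_trans e0 ex))).
apply: (@le_trans _ _ (\int[leb]_(x in I) ((cmod (g x))%:E + (cmod (h x))%:E))%E).
  apply: ae_ge0_le_integral => //.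
  - move=> x; rewrite /I/= in_itv/= => /andP[ex _].
    by rewrite lee_fin invr_ge0 ltW// (lt_trans e0).
  - by move=> x _; rewrite -EFinD lee_fin addr_ge0 ?cmod_ge0.
  - by apply: measurable_funTS; apply: emeasurable_funD; apply/measurable_EFinP.
  - apply: filterS Hu; first exact: (ae_filter_ringOfSetsType leb).
    move=> x Hx; rewrite /I/= in_itv/= => /andP[ex _].
    have xe : 0 < x by exact: lt_trans ex.
    have := hilbert_box e0 ex Hx => Re_u.
    rewrite -EFinD lee_fin; apply: (@le_trans _ _ (cmod (u x))); last first.
      by rewrite uE cmodD.
    apply: le_trans (normr_Re_le _); apply: le_trans (ler_norm _); rewrite Re_u.
    have -> : x - e = x * (1 + (- (e / x))) by field; rewrite gt_eqF.
    have ex1 : 0 < 1 + - (e / x) by rewrite subr_gt0 ltr_pdivrMr// mul1r.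
    rewrite lnM ?posrE// opprD addrA subrr sub0r.
    have : ln (1 + - (e / x)) <= - (e / x) by apply: le_ln1Dx; lra.
    move=> H; rewrite -ler_pdivrMl ?invr_gt0// invrK; lra.
rewrite ge0_integralD//; last 4 first.
- by move=> x _; rewrite lee_fin cmod_ge0.
- by apply: measurable_funTS; apply/measurable_EFinP.
- by move=> x _; rewrite lee_fin cmod_ge0.
- by apply: measurable_funTS; apply/measurable_EFinP.
apply: leeD; last exact: integral_le_Lp_norm.
rewrite Lp_norm1E; apply: ge0_subset_integral => //.
- exact/measurable_EFinP.
- by move=> x _; rewrite lee_fin cmod_ge0.
Qed.

(** The transform of the indicator of [0, 1] is ln x - ln (x - 1) for x > 1,
    which is not essentially bounded near 1. *)
Theorem hilbert_unbounded_cap p : 1 < p ->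
  ~ bounded_on (capLpLoo p%:E) (capLpLoo_norm p%:E) (@hilbert R).
Proof.
move=> p1 [C HC]; have p0 : 0 < p by lra.
have X : capLpLoo p%:E (box (1 : R) 1) by split; [exact: Lp_box|case: (Loo_box (@ler01 R) (@ltr01 R))].
have [u [[_ uoo] Hu _]] := HC _ X.
have [_ _] := (LpP _ _).1 uoo.
have mT : (0 < leb [set: R])%E.
  apply: (@lt_le_trans _ _ (leb (`[0, 1]%classic : set R))).
    by rewrite lebesgue_measure_itv/= lte_fin ltr01 oppr0 adde0 lte_fin.
  by apply: le_measure => //; rewrite inE//; exact: measurable_itv.
rewrite /Lp_norm unlock mT => ess.
have [M hM] : exists M : R, {ae leb, forall x, cmod (u x) <= M}.
  have [M hM] := @ess_supr_bounded _ _ _ leb (fun x => `|cmod (u x)|) ess.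
  exists M; apply: filterS hM => x.
  by apply: le_trans; exact: ler_norm.
(* on ]1, 1 + d[ the transform exceeds M + 1 *)
pose d := expR (- (M + 1)) : R.
have d0 : 0 < d by exact: expR_gt0.
have : {ae leb, forall x : R, x \in `]1, 1 + d[ -> False}.
  apply: filterS2 Hu hM; first exact: (ae_filter_ringOfSetsType leb).
  move=> x Hx xM; rewrite in_itv/= => /andP[x1 xd].
  have Re_u := hilbert_box ltr01 x1 Hx.
  have := le_trans (ler_norm _) (le_trans (normr_Re_le (u x)) xM).
  rewrite Re_u mul1r => H.
  have l1 : 0 <= ln x by rewrite ln_ge0// ltW.
  have : ln (x - 1) < ln d by rewrite ltr_ln ?posrE ?subr_gt0//; lra.
  rewrite /d expRK; lra.
case=> N [mN N0 sN].
have IN : (`]1, 1 + d[%classic : set R) `<=` N.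
  by move=> x xd; apply: sN => /= H; exact: (H xd).
have mI : measurable (`]1, 1 + d[%classic : set R) by exact: measurable_itv.
have L := le_measure leb (mem_set mI) (mem_set mN) IN.
have E := lebesgue_measure_itv `]1, (1 + d)%R[.
rewrite /= lte_fin ltrDl d0 -EFinB in E.
have : ((1 + d - 1)%:E <= 0 :> \bar R)%E.
  have <- : leb N = 0%E := N0.
  by rewrite -E; exact: L.
by rewrite lee_fin; lra.
Qed.

End hilbert_unbounded.

Theorem mainTheorem2 (R : realType) (p : R) (hp : 1 < p) :
  (bounded_on (sumL1Lp (p%:E)) (sumL1Lp_norm (p%:E)) (@segment_mult R) /\
   ~ bounded_on (sumL1Lp (p%:E)) (sumL1Lp_norm (p%:E)) (@hilbert R)) /\
  (bounded_on (capLpLoo (p%:E)) (capLpLoo_norm (p%:E)) (@segment_mult R) /\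
   ~ bounded_on (capLpLoo (p%:E)) (capLpLoo_norm (p%:E)) (@hilbert R)).
Proof.
split; split.
- exact: segment_bounded_sum.
- exact: hilbert_unbounded_sum.
- exact: segment_bounded_cap.
- exact: hilbert_unbounded_cap.
Qed.
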